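(* Let $N\ge 2$ be even, $\beta>0$, and let $p_1,p_2\in(0,1)$ with $p_1+p_2<1$. Let $M$ be the Metropolis chain on $\mathcal X=\{-1,1\}^N$ with stationary distribution $\pi=\pi_{\beta,N}$ and proposal chain $K$ (built from $p_1,p_2$ and the irreducible, symmetric, aperiodic chains $K_0$ and $K_i^{\pm}$, $i=2,4,\dots,N$, as described in the context). Then \[ \mathrm{Gap}(M)\ \ge\ \frac{p_1p_2}{32}\,\frac{1}{(N/2+1)^3}\,\min\Big[\frac{1-p_1}{p_2}\,\mathrm{Gap}(K_0),\ \frac{1-p_1-p_2}{2}\,\min_{i\in\{2,4,\dots,N\}}\min\{\mathrm{Gap}(K_i^+),\mathrm{Gap}(K_i^-)\}\Big]. \] Moreover, suppose $K_0$ and $K_i^\pm$ are the uniform sampling chains, i.e. $K_0(x,y)=1/\binom{N}{N/2}$ for $x,y\in\mathcal X_0$ and $K_i^{\pm}(x,y)=1/\binom{N}{(N-i)/2}$ for $x,y\in\mathcal X_i^\pm$. Then for every $\beta>0$ there exists $N_0$ such that for every even $N\ge N_0$ \[ \mathrm{Gap}(M)\ \ge\ \frac{p_1p_2}{32}\,\frac{1}{(N/2+1)^3}\,\min\Big[\frac{1-p_1-p_2}{2},\ \frac{1-p_1}{p_2}\Big]. \]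
   Context: Spectral gap. For a reversible Markov chain $P$ on a finite set $\mathcal Y$ with eigenvalues $1=\lambda_0\ge\lambda_1\ge\dots\ge\lambda_{|\mathcal Y|-1}\ge -1$ (with multiplicity), $\mathrm{Gap}(P):=1-\max\{\lambda_1,|\lambda_{|\mathcal Y|-1}|\}$; for a chain on a one-point set put $\mathrm{Gap}=1$. Mean field Ising model. $N$ is even, $\mathcal X=\{-1,1\}^N$, $S_N(x)=\sum_{i=1}^N x_i$, and for $\beta>0$ \[ \pi(x)=\pi_{\beta,N}(x)=\exp\{\beta S_N^2(x)/(2N)\}/Z_N(\beta),\qquad Z_N(\beta)=\sum_{x\in\mathcal X}\exp\{\beta S_N^2(x)/(2N)\}. \] For $i=0,2,\dots,N$ let $\mathcal X_i=\{x\in\mathcal X:|S_N(x)|=i\}$, and for $i\neq 0$ let $\mathcal X_i^+=\{x: S_N(x)=i\}$, $\mathcal X_i^-=\{x:S_N(x)=-i\}$. Proposal. Let $K_E(x,y)=\frac1N\sum_{j=1}^N \mathbb I_{\{x^{(j)}\}}(y)$, where $x^{(j)}$ is $x$ with the $j$-th coordinate $x_j$ replaced by $-x_j$. Let $K_0$ be a Markov chain on $\mathcal X_0$ and $K_i^\pm$ Markov chains on $\mathcal X_i^\pm$ ($i=2,4,\dots,N$), all irreducible, symmetric and aperiodic (extended by $0$ to transitions out of the respective set). Put \[ K(x,y)=p_1K_E(x,y)+(1-p_1)K_0(x,y)\quad (x\in\mathcal X_0), \] \[ K(x,y)=p_1K_E(x,y)+p_2\mathbb I_{\{-x\}}(y)+(1-p_1-p_2)K_i^{\pm}(x,y)\quad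 (x\in\mathcal X_i^\pm,\ i\ne0). \] Metropolis chain. $M$ is defined from $K$ and $\pi$ by $M(x,y)=K(x,y)A(x,y)$ for $x\ne y$, and $M(x,x)=K(x,x)+\sum_{z\ne x}K(x,z)(1-A(x,z))$, where $A(x,y)=\min\big(\frac{\pi(y)K(y,x)}{\pi(x)K(x,y)},1\big)$ (when $K(x,y)>0$). It is reversible with stationary distribution $\pi$. *)

(* Defs.v *)
From HB Require Import structures.
From mathcomp Require Import all_boot all_order all_algebra.
From mathcomp Require Import classical_sets reals sequences exp.

Set Implicit Arguments.
Unset Strict Implicit.
Unset Printing Implicit Defensive.

Import Order.TTheory GRing.Theory Num.Theory.

Local Open Scope ring_scope.

Section Chains.
Variables (R : realType) (Y : finType).

Definition kernel := Y -> Y -> R.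

Implicit Type P : kernel.

Definition markov P :=
  (forall x y, 0 <= P x y) /\ (forall x, \sum_(y : Y) P x y = 1).

Definition kernel_mx P : 'M[R]_#|Y| :=
  \matrix_(i, j) P (enum_val i) (enum_val j).

Definition kernel_pow P (n : nat) : kernel :=
  fun x y => (kernel_mx P ^+ n) (enum_rank x) (enum_rank y).

Definition irreducible P := forall x y, exists n, 0 < kernel_pow P n x y.

Definition aperiodic P :=
  forall (x : Y) (d : nat),
    (forall n, (0 < n)%N -> 0 < kernel_pow P n x x -> (d %| n)%N) -> d = 1%N.

Definition symmetric_kernel P := forall x y, P x y = P y x.

(* The eigenvalues in nonincreasing order, repeated according to algebraic
   multiplicity.  This is only meaningful when the characteristic polynomial
   splits over R, which holds for every reversible P (geometric and algebraic
   multiplicities then agree); otherwise it is the junk value [::]. *)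
Definition spectrum P : seq R :=
  xget [::] [set s : seq R | sorted >=%R s /\
    char_poly (kernel_mx P) = \prod_(l <- s) ('X - l%:P)]%classic.

Definition gap P : R :=
  if #|Y| == 1%N then 1
  else 1 - Num.max (spectrum P)`_1 `|(spectrum P)`_(#|Y|.-1)|.

(* Where K x y = 0 the value of [acceptance] is irrelevant, since it is always
   multiplied by K x y. *)
Definition acceptance (mu : Y -> R) (K : kernel) (x y : Y) : R :=
  Num.min (mu y * K y x / (mu x * K x y)) 1.

Definition metropolis (mu : Y -> R) (K : kernel) : kernel := fun x y =>
  if x == y
  then K x x + \sum_(z : Y | z != x) K x z * (1 - acceptance mu K x z)
  else K x y * acceptance mu K x y.

End Chains.

(* A configuration in {-1,1}^N is encoded by booleans: true is the spin 1 and
   false the spin -1. *)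
Notation spins N := {ffun 'I_N -> bool}.

Definition spin (b : bool) : int := if b then 1 else -1.

Definition mag N (x : spins N) : int := \sum_(i < N) spin (x i).

Definition flip N (x : spins N) (j : 'I_N) : spins N :=
  [ffun i => if i == j then ~~ x i else x i].

Definition neg_spins N (x : spins N) : spins N := [ffun i => ~~ x i].

(* X_0 is [level N 0], X_i^+ is [level N i] and X_i^- is [level N (- i)]. *)
Notation level N s := {x : spins N | mag x == s}.

Section Ising.
Variables (R : realType) (N : nat).

Definition ising_weight (beta : R) (x : spins N) : R :=
  expR (beta * (mag x)%:~R ^+ 2 / (2 * N%:R)).

Definition ising (beta : R) (x : spins N) : R :=
  ising_weight beta x / \sum_(y : spins N) ising_weight beta y.

Definition K_E : kernel R (spins N) := fun x y =>
  N%:R^-1 * \sum_(j < N) (y == flip x j)%:R.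

Definition extend0 (s : int) (L : kernel R (level N s)) : kernel R (spins N) :=
  fun x y => if (insub x, insub y) is (Some u, Some v) then L u v else 0.

(* [Kp i] and [Km i] are K_i^+ and K_i^-; only the even i in [2, N] matter when
   N is even. *)
Definition proposal (p1 p2 : R) (K0 : kernel R (level N 0))
    (Kp : forall i : nat, kernel R (level N i%:Z))
    (Km : forall i : nat, kernel R (level N (- i%:Z))) : kernel R (spins N) :=
  fun x y =>
  if mag x == 0 then
    p1 * K_E x y + (1 - p1) * extend0 K0 x y
  else
    p1 * K_E x y + p2 * (y == neg_spins x)%:R
    + (1 - p1 - p2) *
      (if 0 < mag x then extend0 (Kp `|mag x|%N) x y
       else extend0 (Km `|mag x|%N) x y).

Definition level_index (i : nat) : bool := [&& (2 <= i)%N, (i <= N)%N & ~~ odd i].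

Definition admissible (s : int) (L : kernel R (level N s)) : Prop :=
  [/\ markov L, irreducible L, symmetric_kernel L & aperiodic L].

(* The default value of the iterated minimum is the value at i = N, which
   belongs to the range when N >= 2 is even, so this is the minimum over
   i = 2, 4, ..., N. *)
Definition min_gap (Kp : forall i : nat, kernel R (level N i%:Z))
    (Km : forall i : nat, kernel R (level N (- i%:Z))) : R :=
  \big[Num.min/Num.min (gap (Kp N)) (gap (Km N))]_(2 <= i < N.+1 | ~~ odd i)
    Num.min (gap (Kp i)) (gap (Km i)).

End Ising.

(* Main.v *)
Require Import Defs.
From mathcomp Require Import all_boot all_order all_algebra.
From mathcomp Require Import complex ring lra zify.
From mathcomp Require Import classical_sets reals sequences exp.
Import Order.TTheory GRing.Theory Num.Theory.
Local Open Scope ring_scope.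

(** Write <f, g> for the scalar product weighted by the Gibbs measure pi.  A
    number c <= 1 is a lower bound for the gap of a reversible chain M as soon
    as, for all f,
      c Var(f) <= <f, f> - <f, Mf>   and   c <f, f> <= <f, f> + <f, Mf>:
    the first inequality bounds all eigenvalues but the simple eigenvalue 1 from
    above, the second one bounds them from below (gap_ge).  Conversely, an
    orthonormal eigenbasis shows that a symmetric chain satisfies both
    inequalities with c equal to its gap (gap_poincare, gap_poincare_plus).  So
    everything reduces to comparing quadratic forms.

    The proposal K is symmetric, hence the stationary flow of the Metropolis
    chain from x to y <> x is K(x, y) min(pi x, pi y) (metropolis_flow).  The
    form of M is therefore the sum of the forms of three mechanisms: single
    flips, the change of sign of all spins, and moves within the level sets of
    the magnetization.  Moves within levels alone give the inequality for the
    smallest eigenvalue.  For the Poincare inequality the variance of f is split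
    in three parts, one for each mechanism (variance_split).

    - The variance of f inside each level is controlled by the gap of the chain
      of that level (within_sub_form).
    - Let u(a) be the mean of f on the level with a spins equal to 1.  The odd
      part of u under a -> N - a is controlled by the change of sign (neg_form).
    - The variance of the even part of u is controlled by the flips.  By
      Cauchy-Schwarz the flips have at least the energy of u on the path
      0, ..., N (flip_form), and after folding this path at N / 2 = m by symmetry
      (flip_fold), there remains a path of m edges whose vertex weights have no
      interior valley.  On such a path a canonical path argument gives a Poincare
      inequality whose constant is polynomial in N, whatever the temperature
      (path_poincare).

    The absence of an interior valley (unimodal) comes from the ratios
      r(j) = (m - j) / (m + j + 1) * t ^ (2 j + 1),   t = exp(2 beta / N),
    of consecutive weights: they form a log-concave sequence with
    r(1) <= r(0) ^ 3, so that once a ratio is at most 1 all later ones are.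

    Adding up the three parts loses nothing, and the resulting bound is stronger
    than the stated one.  For the uniform chains all the gaps are 1. *)

Set Implicit Arguments.
Unset Strict Implicit.
Unset Printing Implicit Defensive.

(** * Lower bounds for the spectral gap *)

Lemma char_poly_tr (F : comNzRingType) n (A : 'M[F]_n) :
  char_poly A^T = char_poly A.
Proof.
rewrite /char_poly -det_tr; congr (\det _).
by apply/matrixP => i j; rewrite !mxE eq_sym.
Qed.

Lemma char_poly_similar (F : fieldType) n (Q A B : 'M[F]_n) :
  Q \in unitmx -> A *m Q = Q *m B -> char_poly A = char_poly B.
Proof.
rewrite unitmxE unitfE => detQ eqAQ; pose Q' := map_mx polyC Q.
have detQ' : \det Q' != 0 by rewrite det_map_mx polyC_eq0.
suff : char_poly_mx A *m Q' = Q' *m char_poly_mx B.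
  by move/(congr1 determinant); rewrite !det_mulmx mulrC => /(mulfI detQ').
rewrite /char_poly_mx mulmxBl mulmxBr -!map_mxM eqAQ.
by rewrite mul_scalar_mx mul_mx_scalar.
Qed.

Lemma char_poly_ublock (F : comNzRingType) m n (A : 'M[F]_m)
    (B : 'M[F]_(m, n)) (D : 'M[F]_n) :
  char_poly (block_mx A B 0 D) = char_poly A * char_poly D.
Proof.
rewrite /char_poly /char_poly_mx map_block_mx scalar_mx_block.
by rewrite opp_block_mx add_block_mx map_mx0 subr0 det_ublock.
Qed.

Lemma char_poly1 (F : comNzRingType) (a : F) :
  char_poly (a%:M : 'M_1) = 'X - a%:P.
Proof. by rewrite /char_poly det_mx11 !mxE eqxx. Qed.

(** In a basis that starts with the constant vector, A is block triangular with
    upper left entry 1, so a double root X - 1 makes 1 an eigenvalue of the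
    quotient by the constants.  An eigenvector of the quotient lifts to a
    generalized eigenvector f of A.  This is how an algebraic multiplicity,
    which is what the characteristic polynomial sees, is turned into a
    statement about functions. *)
Lemma stochastic_double_root (F : fieldType) n (A : 'M[F]_n) :
  A *m const_mx 1 = const_mx 1 :> 'cV_n ->
  ('X - 1%:P) ^+ 2 %| char_poly A ->
  exists (f : 'cV[F]_n) (b : F),
    (exists i j, f i 0 != f j 0) /\ A *m f = f + const_mx b.
Proof.
case: n A => [|n] A A1 div2.
  have := dvdp_leq (monic_neq0 (char_poly_monic A)) div2.
  by rewrite size_char_poly size_exp_XsubC.
rewrite -[n.+1]/(1 + n)%N in A A1 div2 *.
(* T is A written in the basis whose first vector is the constant vector and
   whose other vectors are the standard ones; Q is the change of basis *)
pose r := ursubmx A; pose B := drsubmx A - const_mx 1 *m r.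
pose Q : 'M[F]_(1 + n) := block_mx 1%:M 0 (const_mx 1) 1%:M.
pose T : 'M[F]_(1 + n) := block_mx 1%:M r 0 B.
have unitQ : Q \in unitmx by rewrite unitmxE det_lblock !det1 mulr1 unitr1.
have [A1u A1d] : ulsubmx A + r *m const_mx 1 = 1%:M /\
    dlsubmx A + drsubmx A *m const_mx 1 = const_mx 1 :> 'cV_n.
  have e : @const_mx F (1 + n) 1 1 = col_mx 1%:M (const_mx 1).
    rewrite -col_mx_const; congr col_mx.
    by apply/matrixP => i j; rewrite !ord1 !mxE.
  move: A1; rewrite -{1}(submxK A) !e mul_block_col !mulmx1.
  by move/eq_col_mx.
have AQ : A *m Q = Q *m T.
  rewrite -{1}(submxK A) !mulmx_block !mul1mx !mulmx1 !mulmx0 !mul0mx !addr0 !add0r.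
  by rewrite A1u A1d /B addrC subrK.
move: div2; rewrite (char_poly_similar unitQ AQ) char_poly_ublock char_poly1.
rewrite expr2 dvdp_mul2l ?polyXsubC_eq0 // -root_factor_theorem -char_poly_tr.
rewrite -eigenvalue_root_char => /eigenvalueP [w wB w0].
have Bw : B *m w^T = w^T by apply: trmx_inj; rewrite trmx_mul !trmxK wB scale1r.
exists (col_mx 0 w^T), ((r *m w^T) 0 0); split.
  have /rV0Pn [j wj] := w0.
  exists (rshift 1 j), (lshift n 0).
  by rewrite col_mxEd col_mxEu !mxE.
rewrite -{1}(submxK A) mul_block_col !mulmx0 !add0r.
have -> : drsubmx A *m w^T = w^T + const_mx 1 *m (r *m w^T).
  by rewrite -{2}Bw /B mulmxBl mulmxA subrK.
rewrite -col_mx_const add_col_mx add0r; congr col_mx.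
  by apply/matrixP => i j; rewrite !ord1 [RHS]mxE.
congr (_ + _); apply/matrixP => i j; rewrite ord1 !mxE big_ord1 mxE mul1r.
by rewrite mxE.
Qed.

Section GapLowerBound.
Variables (R : realType) (Y : finType).
Implicit Types (P : kernel R Y) (mu f g : Y -> R).

Definition inner mu f g : R := \sum_x mu x * f x * g x.
Definition act P f : Y -> R := fun x => \sum_y P x y * f y.
Definition mean mu f : R := \sum_x mu x * f x.

Lemma mul_kernel_mx P (v : 'cV[R]_#|Y|) (f : Y -> R) :
  (forall i, v i 0 = f (enum_val i)) ->
  forall i, (kernel_mx P *m v) i 0 = act P f (enum_val i).
Proof.
move=> vf i; rewrite mxE /act (reindex (fun i : 'I_#|Y| => enum_val i)) /=; last first.
  by exists enum_rank => y _; rewrite (enum_rankK, enum_valK).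
by apply: eq_bigr => j _; rewrite mxE vf.
Qed.

Lemma char_root_eigenfunction P (a : R) :
  root (char_poly (kernel_mx P)) a ->
  exists2 f : Y -> R, (exists y, f y != 0) & forall x, act P f x = a * f x.
Proof.
rewrite -char_poly_tr -eigenvalue_root_char => /eigenvalueP [w wB w0].
have Bw : kernel_mx P *m w^T = a *: w^T.
  by apply: trmx_inj; rewrite trmx_mul linearZ /= !trmxK wB.
pose f y := w^T (enum_rank y) 0.
exists f => [|x].
  have /rV0Pn [j wj] := w0; exists (enum_val j).
  by rewrite /f enum_valK mxE.
have := mul_kernel_mx P (v := w^T) (f := f); rewrite /f => /(_ _ (enum_rank x)).
rewrite Bw enum_rankK mxE => <- // i; by rewrite enum_valK.
Qed.

Lemma char_double_root1 P :
  (forall x, \sum_y P x y = 1) ->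
  ('X - 1%:P) ^+ 2 %| char_poly (kernel_mx P) ->
  exists f b, (exists x y, f x != f y) /\ forall x, act P f x = f x + b.
Proof.
move=> P1 /stochastic_double_root [|f [b [[i [j fij]] Pf]]].
  apply/matrixP => i k; rewrite ord1.
  rewrite (mul_kernel_mx P (f := fun=> 1)) ?[RHS]mxE => [|i']; last by rewrite mxE.
  by rewrite /act -[RHS](P1 (enum_val i)); apply: eq_bigr => y _; rewrite mulr1.
exists (fun y => f (enum_rank y) 0), b; split.
  by exists (enum_val i), (enum_val j); rewrite !enum_valK.
move=> x; rewrite -{1}[x]enum_rankK -(mul_kernel_mx P (v := f)) => [|k]; last by rewrite enum_valK.
by rewrite Pf !mxE.
Qed.

Lemma spectrum_cases P : spectrum P = [::] \/
  sorted >=%R (spectrum P) /\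
  char_poly (kernel_mx P) = \prod_(l <- spectrum P) ('X - l%:P).
Proof. by rewrite /spectrum; case: xgetP => [s _ []|_]; [right|left]. Qed.

Lemma size_spectrum P :
  char_poly (kernel_mx P) = \prod_(l <- spectrum P) ('X - l%:P) ->
  size (spectrum P) = #|Y|.
Proof.
move/(congr1 (fun p : {poly R} => size p)).
by rewrite size_char_poly size_prod_XsubC => -[].
Qed.

Lemma mean_act mu P f :
  (forall y, \sum_x mu x * P x y = mu y) -> mean mu (act P f) = mean mu f.
Proof.
move=> st; rewrite /mean /act.
under eq_bigr do rewrite mulr_sumr.
rewrite exchange_big /=; apply: eq_bigr => y _.
by rewrite -[in RHS](st y) mulr_suml; apply: eq_bigr => x _; rewrite mulrA.
Qed.

Lemma inner_gt0 mu f : (forall x, 0 < mu x) -> (exists y, f y != 0) ->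
  0 < inner mu f f.
Proof.
move=> mu0 [y fy]; rewrite /inner (bigD1 y) //=.
apply: ltr_pwDl; first by rewrite -mulrA pmulr_rgt0 // -expr2 lt_def sqr_ge0 sqrf_eq0 fy.
by apply: sumr_ge0 => x _; rewrite -mulrA mulr_ge0 ?(ltW (mu0 x)) // -expr2 sqr_ge0.
Qed.

(** An eigenfunction of an eigenvalue other than 1 has mean 0 by stationarity, so
    the first inequality puts the eigenvalue below 1 - c; the second one puts
    all eigenvalues above c - 1.  If moreover 1 were a multiple root, then its
    generalized eigenfunction would have Pf = f + b, stationarity would force
    b = 0, and a nonconstant harmonic function contradicts the first inequality
    when c > 0.  When the characteristic polynomial does not split, the gap
    takes the value 1, hence the hypothesis c <= 1. *)
Lemma gap_ge mu P (c : R) :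
  (forall x, 0 < mu x) -> \sum_x mu x = 1 ->
  (forall x, \sum_y P x y = 1) -> (forall y, \sum_x mu x * P x y = mu y) ->
  c <= 1 ->
  (forall f, c * (inner mu f f - mean mu f ^+ 2) <=
             inner mu f f - inner mu f (act P f)) ->
  (forall f, c * inner mu f f <= inner mu f f + inner mu f (act P f)) ->
  c <= gap P.
Proof.
move=> mu0 mu1 P1 st c1 poincare neg; rewrite /gap.
case: eqP => // /eqP Y1.
have Ypos : (1 < #|Y|)%N.
  rewrite ltn_neqAle eq_sym Y1 lt0n; apply/eqP => /card0_eq Y0.
  by move/eqP: mu1; rewrite big_pred0 // eq_sym oner_eq0.
case: (spectrum_cases P) => [-> | [srt fac]].
  by rewrite !nth_nil normr0 maxxx subr0.
have sz := size_spectrum fac; set s := spectrum P in srt fac sz *.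
have innerZ f l : (forall x, act P f x = l * f x) ->
    inner mu f (act P f) = l * inner mu f f.
  by move=> fl; rewrite /inner mulr_sumr; apply: eq_bigr => x _; rewrite fl; ring.
have eig l : l \in s -> exists2 f, 0 < inner mu f f & forall x, act P f x = l * f x.
  move=> ls; have := @char_root_eigenfunction P l.
  rewrite fac root_prod_XsubC ls => /(_ isT) [f f0 fl].
  by exists f => //; apply: inner_gt0.
have lo l : l \in s -> c - 1 <= l.
  case/eig=> f f0 fl; have := neg f; rewrite (innerZ _ _ fl).
  by rewrite -{2}[inner mu f f]mul1r -mulrDl ler_pM2r //; lra.
have hi l : l \in s -> l != 1 -> l <= 1 - c.
  move=> ls l1; have [f f0 fl] := eig l ls.
  have m0 : mean mu f = 0.
    have := mean_act f st.
    have -> : mean mu (act P f) = l * mean mu f.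
      by rewrite /mean mulr_sumr; apply: eq_bigr => x _; rewrite fl; ring.
    move/eqP; rewrite -subr_eq0 -{2}[mean mu f]mul1r -mulrBl mulf_eq0 subr_eq0.
    by rewrite (negPf l1) => /eqP.
  have := poincare f; rewrite (innerZ _ _ fl) m0 expr0n subr0.
  by rewrite -{2}[inner mu f f]mul1r -mulrBl ler_pM2r //; lra.
have mem i : (i < #|Y|)%N -> s`_i \in s by move=> iY; rewrite mem_nth ?sz.
have nth_le i j : (i <= j)%N -> (j < #|Y|)%N -> s`_j <= s`_i.
  move=> ij jY.
  have tr : transitive (>=%R : rel R) by move=> a b d /= ab bd; apply: le_trans bd ab.
  have rf : reflexive (>=%R : rel R) by move=> a /=.
  apply: (sorted_leq_nth tr rf 0 srt) => //; rewrite inE sz //.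
  exact: leq_ltn_trans jY.
have s1 : s`_1 <= 1 - c.
  have [e1|] := eqVneq s`_1 1; last exact/hi/mem.
  rewrite e1; case: (lerP c 0) => [|c0]; first lra.
  have e0 : s`_0 = 1.
    apply/eqP/negP => /negP /hi; rewrite mem 1?ltnW // => /(_ isT).
    have := nth_le 0%N 1%N isT Ypos; rewrite e1; lra.
  have [f [b [[x [y fxy]] fb]]] : exists f b,
      (exists x y, f x != f y) /\ forall x, act P f x = f x + b.
    apply: char_double_root1 => //; rewrite fac.
    move: Ypos e0 e1; rewrite -sz; case: (s) => [|a [|a' s']] //= _ -> ->.
    by rewrite !big_cons mulrA expr2 dvdp_mulr.
  have b0 : b = 0.
    have := mean_act f st.
    have -> : mean mu (act P f) = mean mu f + b.
      rewrite /mean -[b in RHS]mul1r -mu1 mulr_suml -big_split /=.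
      by apply: eq_bigr => z _; rewrite fb mulrDr.
    by move=> e; apply: (addrI (mean mu f)); rewrite addr0.
  pose g z := f z - mean mu f.
  have mg : mean mu g = 0.
    rewrite {1}/mean; under eq_bigr do rewrite mulrBr.
    by rewrite sumrB -mulr_suml mu1 mul1r subrr.
  have Pg z : act P g z = 1 * g z.
    rewrite {1}/act; under eq_bigr do rewrite mulrBr.
    by rewrite sumrB -mulr_suml P1 !mul1r -/(act P f z) fb b0 addr0.
  have := poincare g; rewrite (innerZ _ _ Pg) mg expr0n mul1r !subr0 subrr.
  rewrite pmulr_rle0 // leNgt inner_gt0 //.
  have [gx0|] := eqVneq (g x) 0; last by exists x.
  exists y; apply: contra fxy => /eqP gy0; apply/eqP.
  by move: gx0 gy0; rewrite /g => /subr0_eq -> /subr0_eq ->.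
have Ylt : (#|Y|.-1 < #|Y|)%N by rewrite prednK // ltnW.
have last_le : s`_(#|Y|.-1) <= s`_1 by apply: nth_le => //; rewrite -ltnS prednK // ltnW.
have lo_last := lo _ (mem _ Ylt).
suff: Num.max s`_1 `|s`_(#|Y|.-1)| <= 1 - c by lra.
by rewrite ge_max s1 ler_norml; apply/andP; split; lra.
Qed.

End GapLowerBound.

(** * Diagonalization of real symmetric matrices *)

Section SymmetricSpectral.
Local Open Scope sesquilinear_scope.
Variables (R : realType) (n : nat) (A : 'M[R]_n).
Local Notation C := (R[i]%C).
Local Notation toC := (real_complex R).
Hypothesis Asym : A^T = A.

(** The coordinates w i f are those of f in an orthonormal eigenbasis of the
    complexified matrix.  They are complex, but the eigenvalues are real, and
    this is enough to express the real quadratic forms of A. *)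
Lemma symmetric_diagonalization :
  exists (d : 'I_n -> R) (w : 'I_n -> 'cV[R]_n -> C),
  [/\ char_poly A = \prod_i ('X - (d i)%:P),
      forall f g : 'cV[R]_n,
        toC (\sum_i f i 0 * g i 0) = \sum_i w i f * (w i g)^* &
      forall f i, w i (A *m f) = toC (d i) * w i f].
Proof.
pose A' : 'M[C]_n := map_mx toC A.
have A'herm : A' \is hermsymmx.
  apply: realsym_hermsym.
    by apply/is_hermitianmxP; rewrite expr0 scale1r map_mx_id // map_trmx Asym.
  by apply/mxOverP => i j; rewrite mxE; apply/complex_realP; exists (A i j).
have /orthomx_spectralP := hermitian_normalmx A'herm.
have /mxOverP dreal := hermitian_spectral_diag_real A'herm.
have Uun := spectral_unitarymx A'.
move: dreal Uun; set U := spectralmx A'; set D := spectral_diag A'.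
move=> dreal Uun A'E; rewrite invmx_unitary // in A'E.
have /unitarymxP UU := Uun.
pose d i := complex.Re (D 0 i).
have dE i : toC (d i) = D 0 i by apply: RRe_real.
exists d, (fun i f => (U *m map_mx toC f) i 0); split.
- apply: (map_poly_inj toC).
  rewrite map_char_poly -/A' A'E.
  have -> : char_poly (U ^t* *m diag_mx D *m U) = char_poly (diag_mx D).
    apply: (@char_poly_similar _ _ (U ^t* )); first by rewrite unitarymx_unit ?trmxC_unitary.
    by rewrite -!mulmxA UU mulmx1.
  rewrite char_poly_trig ?diag_mx_is_trig // rmorph_prod.
  apply: eq_bigr => i _.
  by rewrite rmorphB /= map_polyX map_polyC /= dE !mxE eqxx.
- move=> f g.
  transitivity (((U *m map_mx toC g)^t* *m (U *m map_mx toC f)) 0 0).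
    rewrite trmx_mul map_mxM -mulmxA [_ *m (U *m _)]mulmxA (mulmx1C UU) mul1mx.
    rewrite !mxE rmorph_sum; apply: eq_bigr => i _; rewrite !mxE rmorphM mulrC.
    congr (_ * _); apply/esym/CrealP/complex_realP; by exists (g i 0).
  by rewrite mxE; apply: eq_bigr => i _; rewrite [RHS]mulrC; congr (_ * _); rewrite !mxE.
- move=> f i; rewrite map_mxM -/A' A'E !mulmxA UU mul1mx -mulmxA mul_diag_mx.
  by rewrite mxE dE.
Qed.

End SymmetricSpectral.

(** * Quadratic forms of reversible chains *)

Section Dirichlet.
Variables (R : realType) (Y : finType).
Implicit Types (P : kernel R Y) (mu f : Y -> R).

(** Expand the square: reversibility and unit row sums make both diagonal terms
    equal to the squared norm.  Only the signs s = 1 and s = -1 satisfy the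
    last hypothesis, and they give the two forms below. *)
Lemma sum_pairs_sqr mu P (s : R) f :
  (forall x, \sum_y P x y = 1) -> (forall x y, mu x * P x y = mu y * P y x) ->
  s ^+ 2 = 1 ->
  \sum_x \sum_y mu x * P x y * (f x + s * f y) ^+ 2 =
  2 * (inner mu f f + s * inner mu f (act P f)).
Proof.
move=> P1 rev s1.
have diag1 : \sum_x \sum_y mu x * P x y * f x ^+ 2 = inner mu f f.
  rewrite /inner; apply: eq_bigr => x _; rewrite -mulr_suml -mulr_sumr P1; ring.
have diag2 : \sum_x \sum_y mu x * P x y * f y ^+ 2 = inner mu f f.
  rewrite exchange_big -diag1; apply: eq_bigr => y _.
  by apply: eq_bigr => x _; rewrite rev.
have cross : \sum_x \sum_y mu x * P x y * (f x * f y) = inner mu f (act P f).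
  rewrite /inner /act; apply: eq_bigr => x _; rewrite mulr_sumr.
  by apply: eq_bigr => y _; ring.
transitivity (inner mu f f + 2 * s * inner mu f (act P f) + inner mu f f); last by ring.
rewrite -{1}diag1 -diag2 -cross mulr_sumr -!big_split /=.
apply: eq_bigr => x _; rewrite mulr_sumr -!big_split /=.
apply: eq_bigr => y _.
have -> : (f x + s * f y) ^+ 2 = f x ^+ 2 + 2 * s * (f x * f y) + s ^+ 2 * f y ^+ 2.
  by ring.
by rewrite s1; ring.
Qed.

Lemma sum_pairs_sub mu P f :
  (forall x, \sum_y P x y = 1) -> (forall x y, mu x * P x y = mu y * P y x) ->
  \sum_x \sum_y mu x * P x y * (f x - f y) ^+ 2 =
  2 * (inner mu f f - inner mu f (act P f)).
Proof.
move=> P1 rev; rewrite -mulN1r -sum_pairs_sqr ?sqrrN ?expr1n //.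
by apply: eq_bigr => x _; apply: eq_bigr => y _; rewrite mulN1r.
Qed.

Lemma sum_pairs_add mu P f :
  (forall x, \sum_y P x y = 1) -> (forall x y, mu x * P x y = mu y * P y x) ->
  \sum_x \sum_y mu x * P x y * (f x + f y) ^+ 2 =
  2 * (inner mu f f + inner mu f (act P f)).
Proof.
move=> P1 rev; rewrite -[inner mu f (act P f)]mul1r -sum_pairs_sqr ?expr1n //.
by apply: eq_bigr => x _; apply: eq_bigr => y _; rewrite mul1r.
Qed.

Lemma stationary_of_reversible mu P :
  (forall x, \sum_y P x y = 1) -> (forall x y, mu x * P x y = mu y * P y x) ->
  forall y, \sum_x mu x * P x y = mu y.
Proof.
move=> P1 rev y; under eq_bigr do rewrite rev.
by rewrite -mulr_sumr P1 mulr1.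
Qed.

End Dirichlet.

Section GapUpper.
Variables (R : realType) (Y : finType) (K : kernel R Y).
Hypotheses (Kmarkov : markov K) (Ksym : symmetric_kernel K).

Let one : Y -> R := fun=> 1.

Let K0 x y : 0 <= K x y. Proof. by case: Kmarkov. Qed.
Let K1 x : \sum_y K x y = 1. Proof. by case: Kmarkov. Qed.
Let rev x y : one x * K x y = one y * K y x. Proof. by rewrite Ksym. Qed.

Lemma gap_le1 : gap K <= 1.
Proof.
rewrite /gap; case: ifP => // _.
by rewrite lerBlDr lerDl le_max normr_ge0 orbT.
Qed.

Lemma inner_act_le f : inner one f (act K f) <= inner one f f.
Proof.
suff : 0 <= 2 * (inner one f f - inner one f (act K f)).
  by rewrite pmulr_rge0 // subr_ge0.
rewrite -sum_pairs_sub //; apply: sumr_ge0 => x _; apply: sumr_ge0 => y _.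
by rewrite mul1r mulr_ge0 ?sqr_ge0.
Qed.

Lemma char_root_le1 a : root (char_poly (kernel_mx K)) a -> a <= 1.
Proof.
case/char_root_eigenfunction => f f0 fa.
have pos : 0 < inner one f f by apply: inner_gt0 => // x; exact: ltr01.
have e : inner one f (act K f) = a * inner one f f.
  by rewrite /inner mulr_sumr; apply: eq_bigr => x _; rewrite fa; ring.
by have := inner_act_le f; rewrite e -{2}[inner _ _ _]mul1r ler_pM2r.
Qed.

(** Converse of gap_ge for a symmetric chain.  In an orthonormal eigenbasis both
    inequalities hold coordinate by coordinate.  The only delicate coordinate
    of the first is one whose eigenvalue d i exceeds the second largest, l1:
    it is unique, and l1 < d i <= 1, so that the constant function, which is
    fixed by K, has all its other coordinates equal to 0.  Orthogonality to the
    constants then says that f has no i-th coordinate. *)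
Lemma symmetric_gap_quadratic_forms : (1 < #|Y|)%N ->
  (forall f, mean one f = 0 ->
     gap K * inner one f f <= inner one f f - inner one f (act K f)) /\
  (forall f, gap K * inner one f f <= inner one f f + inner one f (act K f)).
Proof.
move=> Y1.
have Asym : (kernel_mx K)^T = kernel_mx K.
  by apply/matrixP => i j; rewrite !mxE Ksym.
have [d [w [fac w_inner w_act]]] := symmetric_diagonalization Asym.
(* z f i is the i-th coordinate of f and q f i its squared modulus *)
pose vec f : 'cV[R]_#|Y| := \col_i f (enum_val i).
pose z f i := w i (vec f); pose q f i := complex.Re (z f i * (z f i)^*)%R.
have qE f i : (q f i)%:C%C = z f i * (z f i)^*.
  by apply: RRe_real; rewrite -normCK realX // normr_real.
have q0 f i : 0 <= q f i.
  by rewrite -lecR (qE f i) -normCK exprn_ge0.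
have zact f i : z (act K f) i = (d i)%:C%C * z f i.
  rewrite /z -w_act; congr w; apply/colP => j.
  by rewrite (mul_kernel_mx K (f := f)) => [|k]; rewrite mxE.
have innerE f g : (inner one f g)%:C%C = \sum_i z f i * (z g i)^*.
  rewrite -w_inner; congr (_%:C%C); rewrite /inner.
  rewrite (reindex (fun i : 'I_#|Y| => enum_val i)) /=; last first.
    by exists enum_rank => y _; rewrite (enum_rankK, enum_valK).
  by apply: eq_bigr => i _; rewrite !mxE mul1r.
have normE f : inner one f f = \sum_i q f i.
  apply: (@complexI R); rewrite innerE rmorph_sum.
  by apply: eq_bigr => i _; rewrite /= qE.
have actE f : inner one f (act K f) = \sum_i d i * q f i.
  apply: (@complexI R); rewrite innerE rmorph_sum.
  apply: eq_bigr => i _; rewrite zact rmorphM [RHS]rmorphM /= qE mulrCA.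
  by congr (_ * _); apply/CrealP/complex_realP; exists (d i).
have [srt sfac] : sorted >=%R (spectrum K) /\
    char_poly (kernel_mx K) = \prod_(l <- spectrum K) ('X - l%:P).
  rewrite /spectrum; set S := [set s | _]%classic.
  suff Sne : exists s, S s by exact: (xgetPex [::] Sne).
  exists (sort >=%R [seq d i | i <- enum 'I_#|Y|]); split.
    by apply: sort_sorted => a b; rewrite /= orbC le_total.
  by rewrite (perm_big _ (permEl (perm_sort _ _))) /= big_map fac big_enum.
have sd : perm_eq (spectrum K) [seq d i | i <- enum 'I_#|Y|].
  apply: prod_XsubC_eq; rewrite -sfac fac big_map big_enum; by [].
have sz := size_spectrum sfac; set s := spectrum K in srt sfac sd sz *.
have tr : transitive (>=%R : rel R) by move=> a b c /= ab bc; apply: le_trans bc ab.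
have rf : reflexive (>=%R : rel R) by move=> a /=.
have ds i : d i \in s by rewrite (perm_mem sd) map_f // mem_enum.
have d1 i : d i <= 1 by apply: char_root_le1; rewrite sfac root_prod_XsubC.
have gapE : gap K = 1 - Num.max s`_1 `|s`_(#|Y|.-1)|.
  by rewrite /gap ifN // neq_ltn Y1 orbT.
have d_last i : s`_(#|Y|.-1) <= d i.
  rewrite -(nth_index 0 (ds i)).
  have := ds i; rewrite -index_mem => lt_i.
  apply: (sorted_leq_nth tr rf 0 srt); rewrite ?inE //.
    by rewrite sz prednK // ltnW.
  by rewrite -ltnS prednK ?(ltnW Y1) // -sz.
have uniq_top i j : s`_1 < d i -> s`_1 < d j -> i = j.
  have : (count (fun x => (s`_1 < x)%R) s <= 1)%N.
    move: srt; rewrite /= (sorted_pairwise tr); move: Y1; rewrite -sz.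
    case: (s) => [|a [|b s']] //= _ /andP [_ /andP [bs _]].
    rewrite ltxx (_ : count _ s' = 0%N) ?addn0 ?leq_b1 //.
    apply/eqP; rewrite -leqn0 leqNgt -has_count; apply/hasPn => x xs.
    by rewrite -leNgt; apply: (allP bs).
  rewrite (permP sd) count_map -size_filter => le1 di dj.
  have mem k : s`_1 < d k -> k \in [seq x <- enum 'I_#|Y| | s`_1 < d x].
    by move=> dk; rewrite mem_filter dk mem_enum.
  move: (mem _ di) (mem _ dj) le1 => {mem}.
  by case: [seq x <- _ | _] => [|a [|]] //; rewrite !inE => /eqP -> /eqP ->.
split=> f; last first.
  rewrite normE actE mulr_sumr -big_split /=; apply: ler_sum => i _.
  rewrite -{2}[q f i]mul1r -mulrDl ler_wpM2r // gapE.
  have : - `|s`_(#|Y|.-1)| <= s`_(#|Y|.-1) by rewrite lerNl -normrN ler_norm.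
  have : `|s`_(#|Y|.-1)| <= Num.max s`_1 `|s`_(#|Y|.-1)| by rewrite le_max lexx orbT.
  have := d_last i; lra.
move=> f0; rewrite normE actE mulr_sumr -sumrB /=; apply: ler_sum => i _.
rewrite -{2}[q f i]mul1r -mulrBl gapE.
have s1 : s`_1 <= Num.max s`_1 `|s`_(#|Y|.-1)| by rewrite le_max lexx.
have [di|di] := lerP (d i) s`_1; first by rewrite ler_wpM2r //; lra.
suff -> : q f i = 0 by rewrite !mulr0.
have z1 j : j != i -> z one j = 0.
  move=> ji; have : z (act K one) j = z one j.
    congr w; apply/colP => k; rewrite !mxE /act -[RHS](K1 (enum_val k)).
    by apply: eq_bigr => y _; rewrite mulr1.
  rewrite zact => /eqP; rewrite -subr_eq0 -{2}[z one j]mul1r -mulrBl mulf_eq0.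
  case/orP => [|/eqP //]; rewrite subr_eq0 => /eqP/complexI dj1.
  case/eqP: ji; apply: uniq_top => //; rewrite dj1; exact: lt_le_trans di (d1 i).
have zi1 : z one i != 0.
  apply/eqP => zi; have : (inner one one one)%:C%C = 0 :> R[i]%C.
    rewrite innerE big1 // => j _.
    by have [->|/z1 ->] := eqVneq j i; rewrite ?zi mul0r.
  move/(@complexI R)/eqP; rewrite gt_eqF // inner_gt0 //.
  by exists (enum_val i); rewrite oner_eq0.
have : (inner one f one)%:C%C = 0 :> R[i]%C.
  suff -> : inner one f one = 0 by rewrite rmorph0.
  by rewrite -f0; apply: eq_bigr => x _; rewrite mulr1.
rewrite innerE (bigD1 i) //= big1 => [|j /z1 ->]; last by rewrite rmorph0 mulr0.
rewrite addr0 => /eqP; rewrite mulf_eq0 conjC_eq0 (negPf zi1) orbF => /eqP zf.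
by apply: (@complexI R); rewrite qE zf mul0r.
Qed.

End GapUpper.

Section GapForms.
Variables (R : realType) (Y : finType) (K : kernel R Y).
Hypotheses (Kmarkov : markov K) (Ksym : symmetric_kernel K).
Hypothesis Y0 : (0 < #|Y|)%N.

Implicit Types (x y : Y) (f g : Y -> R).

Let one : Y -> R := fun=> 1.

Let K0 x y : 0 <= K x y. Proof. by case: Kmarkov. Qed.
Let K1 x : \sum_y K x y = 1. Proof. by case: Kmarkov. Qed.
Let rev x y : one x * K x y = one y * K y x. Proof. by rewrite Ksym. Qed.

Let sub_form f : \sum_x \sum_y K x y * (f x - f y) ^+ 2 =
  2 * (inner one f f - inner one f (act K f)).
Proof.
rewrite -sum_pairs_sub //.
by apply: eq_bigr => x _; apply: eq_bigr => y _; rewrite mul1r.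
Qed.

Let add_form f : \sum_x \sum_y K x y * (f x + f y) ^+ 2 =
  2 * (inner one f f + inner one f (act K f)).
Proof.
rewrite -sum_pairs_add //.
by apply: eq_bigr => x _; apply: eq_bigr => y _; rewrite mul1r.
Qed.

Let norm_form f : inner one f f = \sum_x f x ^+ 2.
Proof. by apply: eq_bigr => x _; rewrite mul1r. Qed.

Lemma sum_singleton : #|Y| = 1%N ->
  exists x0, forall F : Y -> R, \sum_y F y = F x0.
Proof.
move=> Y1; have /card_gt0P [x0 _] := Y0; exists x0 => F.
rewrite (bigD1 x0) //= big1 ?addr0 // => y.
have /card_le1_eqP eqY : (#|Y| <= 1)%N by rewrite Y1.
by rewrite (eqY y x0) ?eqxx.
Qed.

Lemma sum_sqr_sub_mean f :
  \sum_x (f x - (\sum_y f y) / #|Y|%:R) ^+ 2 =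
  \sum_x f x ^+ 2 - (\sum_x f x) ^+ 2 / #|Y|%:R.
Proof.
set S := \sum_y f y; have n0 : #|Y|%:R != 0 :> R by rewrite pnatr_eq0 -lt0n.
transitivity (\sum_x (f x ^+ 2 - 2 * (S / #|Y|%:R) * f x + (S / #|Y|%:R) ^+ 2)).
  by apply: eq_bigr => x _; ring.
rewrite big_split sumrB -mulr_sumr sumr_const /= -/S -[_ *+ #|_|]mulr_natr.
by field.
Qed.

Lemma gap_poincare f :
  2 * gap K * (\sum_x f x ^+ 2 - (\sum_x f x) ^+ 2 / #|Y|%:R) <=
  \sum_x \sum_y K x y * (f x - f y) ^+ 2.
Proof.
have n0 : #|Y|%:R != 0 :> R by rewrite pnatr_eq0 -lt0n.
move: Y0; rewrite leq_eqVlt => /orP [/eqP /esym Y1|Y1].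
  have [x0 one_sum] := sum_singleton Y1.
  rewrite !one_sum subrr expr0n mulr0.
  by rewrite Y1 divr1 subrr mulr0.
pose g x := f x - (\sum_y f y) / #|Y|%:R.
have g0 : mean one g = 0.
  rewrite /mean; under eq_bigr do rewrite mul1r.
  by rewrite sumrB sumr_const -[_ *+ #|_|]mulr_natr divfK ?subrr.
rewrite -sum_sqr_sub_mean -mulrA -(norm_form g).
have -> : \sum_x \sum_y K x y * (f x - f y) ^+ 2 =
          \sum_x \sum_y K x y * (g x - g y) ^+ 2.
  by apply: eq_bigr => x _; apply: eq_bigr => y _; rewrite /g; ring.
rewrite sub_form ler_pM2l //.
by have [/(_ g g0)] := symmetric_gap_quadratic_forms Kmarkov Ksym Y1.
Qed.

Lemma gap_poincare_plus f :
  2 * gap K * (\sum_x f x ^+ 2) <= \sum_x \sum_y K x y * (f x + f y) ^+ 2.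
Proof.
rewrite add_form -mulrA -norm_form ler_pM2l //.
move: Y0; rewrite leq_eqVlt => /orP [/eqP /esym Y1|Y1]; last first.
  by have [_ /(_ f)] := symmetric_gap_quadratic_forms Kmarkov Ksym Y1.
have [x0 one_sum] := sum_singleton Y1.
have K00 : K x0 x0 = 1 by rewrite -(K1 x0) one_sum.
rewrite /gap Y1 /= /inner /act !one_sum K00 !mul1r lerDl -expr2; exact: sqr_ge0.
Qed.

Let mu0 : forall x : Y, 0 < (fun=> #|Y|%:R^-1 : R) x.
Proof. by move=> x; rewrite invr_gt0 ltr0n. Qed.

Let mu1 : \sum_(x : Y) (#|Y|%:R^-1 : R) = 1.
Proof. by rewrite sumr_const -[_ *+ #|_|]mulr_natr mulVf // pnatr_eq0 -lt0n. Qed.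

Let innerE f g : inner (fun=> #|Y|%:R^-1) f g = #|Y|%:R^-1 * inner one f g.
Proof. by rewrite /inner mulr_sumr; apply: eq_bigr => x _; rewrite mul1r mulrA. Qed.

Lemma gap_ge0 : 0 <= gap K.
Proof.
apply: (gap_ge mu0 mu1) => // [y|f|f].
- by rewrite -mulr_sumr; under eq_bigr do rewrite Ksym; rewrite K1 mulr1.
- rewrite mul0r !innerE -mulrBr mulr_ge0 ?invr_ge0 // -(@pmulr_rge0 _ 2) //.
  rewrite -sub_form.
  by apply: sumr_ge0 => x _; apply: sumr_ge0 => y _; rewrite mulr_ge0 ?sqr_ge0.
rewrite mul0r !innerE -mulrDr mulr_ge0 ?invr_ge0 // -(@pmulr_rge0 _ 2) //.
rewrite -add_form.
by apply: sumr_ge0 => x _; apply: sumr_ge0 => y _; rewrite mulr_ge0 ?sqr_ge0.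
Qed.

(** The uniform kernel is the orthogonal projection on the constants. *)
Lemma gap_uniform_ge1 : (forall x y, K x y = #|Y|%:R^-1) -> 1 <= gap K.
Proof.
move=> KE; have actE f x : act K f x = mean (fun=> #|Y|%:R^-1) f.
  by apply: eq_bigr => y _; rewrite KE.
have inner_act f : inner (fun=> #|Y|%:R^-1) f (act K f) =
    mean (fun=> #|Y|%:R^-1) f ^+ 2.
  by rewrite /inner expr2 [X in X * _]/mean mulr_suml; apply: eq_bigr => x _; rewrite actE.
apply: (gap_ge mu0 mu1) => // [y|f|f].
- by rewrite -mulr_sumr; under eq_bigr do rewrite Ksym; rewrite K1 mulr1.
- by rewrite mul1r inner_act.
by rewrite mul1r inner_act lerDl sqr_ge0.
Qed.

End GapForms.

(** * Metropolis chains with a symmetric proposal *)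

Section Metropolis.
Variables (R : realType) (Y : finType) (mu : Y -> R) (K : kernel R Y).
Hypotheses (mu0 : forall x, 0 < mu x) (mu1 : \sum_x mu x = 1).
Hypotheses (Kmarkov : markov K) (Ksym : symmetric_kernel K).
Implicit Types (x y : Y) (f : Y -> R).

Let M := metropolis mu K.

Let K0 x y : 0 <= K x y. Proof. by case: Kmarkov. Qed.
Let K1 x : \sum_y K x y = 1. Proof. by case: Kmarkov. Qed.

(** For a symmetric proposal the proposal probabilities cancel in the acceptance
    ratio, and the stationary flow through an edge is explicit. *)
Lemma metropolis_flow x y : x != y ->
  mu x * M x y = K x y * Num.min (mu x) (mu y).
Proof.
move=> xy; rewrite /M /metropolis (negPf xy) /acceptance (Ksym y x).
have [-> | Kxy] := eqVneq (K x y) 0; first by rewrite !mul0r mulr0.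
have mux : mu x != 0 by rewrite gt_eqF.
have -> : mu y * K x y / (mu x * K x y) = mu y / mu x by field; rewrite mux Kxy.
rewrite mulrCA minr_pMr ?ltW // mulr1 mulrC [_ * _^-1]mulrC mulVKf // mulrC minC.
by [].
Qed.

Lemma metropolis_diag x : K x x <= M x x.
Proof.
rewrite /M /metropolis eqxx lerDl; apply: sumr_ge0 => z _.
by rewrite mulr_ge0 // subr_ge0 ge_min lexx orbT.
Qed.

Lemma metropolis_row x : \sum_y M x y = 1.
Proof.
rewrite -(K1 x) (bigD1 x) //= [in RHS](bigD1 x) //= /M /metropolis eqxx -addrA.
congr (_ + _); rewrite -big_split /=; apply: eq_bigr => y yx.
by rewrite eq_sym (negPf yx); ring.
Qed.

Lemma metropolis_reversible x y : mu x * M x y = mu y * M y x.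
Proof.
have [->//|xy] := eqVneq x y.
have yx : y != x by rewrite eq_sym.
by rewrite !metropolis_flow // minC Ksym.
Qed.

(** In the form with the difference the diagonal of M disappears; in the form with
    the sum it only helps, because rejections make M x x at least K x x. *)
Lemma metropolis_gap_ge (c : R) : c <= 1 ->
  (forall f, 2 * c * (\sum_x mu x * f x ^+ 2 - (\sum_x mu x * f x) ^+ 2) <=
     \sum_x \sum_y K x y * Num.min (mu x) (mu y) * (f x - f y) ^+ 2) ->
  (forall f, 2 * c * (\sum_x mu x * f x ^+ 2) <=
     \sum_x \sum_y K x y * Num.min (mu x) (mu y) * (f x + f y) ^+ 2) ->
  c <= gap M.
Proof.
move=> c1 poincare neg.
have norm f : inner mu f f = \sum_x mu x * f x ^+ 2.
  by apply: eq_bigr => x _; ring.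
have st := stationary_of_reversible metropolis_row metropolis_reversible.
apply: (gap_ge mu0 mu1 metropolis_row st c1) => f.
  rewrite -(@ler_pM2l _ 2) // -sum_pairs_sub;
    [|exact: metropolis_row|exact: metropolis_reversible].
  rewrite mulrA norm; apply: le_trans (poincare f) _.
  apply: ler_sum => x _; apply: ler_sum => y _.
  have [->|xy] := eqVneq x y; first by rewrite subrr expr0n /= !mulr0.
  by rewrite -metropolis_flow.
rewrite -(@ler_pM2l _ 2) // -sum_pairs_add;
  [|exact: metropolis_row|exact: metropolis_reversible].
rewrite mulrA norm; apply: le_trans (neg f) _.
apply: ler_sum => x _; apply: ler_sum => y _.
have [<-|xy] := eqVneq x y; last by rewrite -metropolis_flow.
by rewrite ler_wpM2r ?sqr_ge0 // minxx mulrC ler_wpM2l ?metropolis_diag ?ltW.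
Qed.

End Metropolis.

(** * A Poincare inequality on the path *)

Section PathPoincare.
Variable R : realType.

Lemma sum_pair_variance (I : finType) (W F : I -> R) :
  \sum_a \sum_b W a * W b * (F a - F b) ^+ 2 =
  2 * ((\sum_a W a) * (\sum_a W a * F a ^+ 2) - (\sum_a W a * F a) ^+ 2).
Proof.
have e1 : \sum_a \sum_b W a * W b * F a ^+ 2 = (\sum_a W a) * \sum_a W a * F a ^+ 2.
  rewrite mulrC mulr_suml; apply: eq_bigr => a _; rewrite mulr_sumr.
  by apply: eq_bigr => b _; ring.
have e2 : \sum_a \sum_b W a * W b * F b ^+ 2 = (\sum_a W a) * \sum_a W a * F a ^+ 2.
  by rewrite exchange_big -e1 /=; apply: eq_bigr => a _; apply: eq_bigr => b _; ring.
have e3 : \sum_a \sum_b W a * W b * (F a * F b) = (\sum_a W a * F a) ^+ 2.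
  rewrite expr2 mulr_suml; apply: eq_bigr => a _; rewrite mulr_sumr.
  by apply: eq_bigr => b _; ring.
rewrite mulrBr mulr2n mulrDl !mul1r -{1}e1 -e2 -e3 mulr_sumr -sumrN -!big_split /=.
apply: eq_bigr => a _; rewrite mulr_sumr -sumrN -!big_split /=.
by apply: eq_bigr => b _; ring.
Qed.

Lemma sum_cauchy_schwarz (I : finType) (W c : I -> R) : (forall a, 0 <= W a) ->
  (\sum_a W a * c a) ^+ 2 <= (\sum_a W a) * \sum_a W a * c a ^+ 2.
Proof.
move=> W0; rewrite -subr_ge0 -(@pmulr_rge0 _ 2) // -sum_pair_variance.
by apply: sumr_ge0 => a _; apply: sumr_ge0 => b _; rewrite mulr_ge0 ?sqr_ge0 // mulr_ge0.
Qed.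

Lemma sqr_sum_le_card (I : finType) (P : pred I) (c : I -> R) :
  (\sum_(a | P a) c a) ^+ 2 <= #|P|%:R * \sum_(a | P a) c a ^+ 2.
Proof.
have ind (F : I -> R) : \sum_a (P a)%:R * F a = \sum_(a | P a) F a.
  rewrite [RHS]big_mkcond; apply: eq_bigr => a _.
  by case: (P a); rewrite ?mul1r ?mul0r.
have := @sum_cauchy_schwarz _ (fun a => (P a)%:R) c (fun a => ler0n _ _).
have -> : \sum_a (P a)%:R = #|P|%:R :> R.
  by rewrite -sumr_const -ind; apply: eq_bigr => a _; rewrite mulr1.
by rewrite !ind.
Qed.

Lemma sum_telescope_sqr (G : nat -> R) (i j m : nat) : (i <= j)%N -> (j <= m)%N ->
  (G i - G j) ^+ 2 <= m%:R * \sum_(i <= k < j) (G k - G k.+1) ^+ 2.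
Proof.
move=> ij jm.
have reindex (F : nat -> R) : \sum_(i <= k < j) F k = \sum_(k < j - i) F (k + i)%N.
  by rewrite -{1}(add0n i) big_addn big_mkord.
rewrite -[G i - G j]opprB sqrrN -(telescope_sumr G ij) !reindex.
apply: le_trans
  (sqr_sum_le_card predT (fun k : 'I_(j - i) => G (k + i).+1 - G (k + i)%N)) _.
rewrite card_ord; under eq_bigr do rewrite -sqrrN opprB.
rewrite ler_wpM2r ?ler_nat ?(leq_trans _ jm) ?leq_subr //.
by apply: sumr_ge0 => k _; exact: sqr_ge0.
Qed.

(** The canonical path bound for weights without an interior valley: along the
    path from i to j all the weights are at least the smaller one of w i and
    w j, so that w i * w j <= (w i + w j) * w k for every k on the path.  The
    labels h a let several points share a vertex of the path: two levels with
    opposite magnetizations are folded onto the same vertex. *)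
Lemma path_poincare (I : finType) (h : I -> nat) (m : nat) (w G : nat -> R) :
  (forall a, (h a <= m)%N) -> (forall k, 0 <= w k) ->
  (forall i j k, (i <= k)%N -> (k <= j)%N -> (j <= m)%N ->
     Num.min (w i) (w j) <= w k) ->
  \sum_a w (h a) = 1 ->
  \sum_a w (h a) * G (h a) ^+ 2 - (\sum_a w (h a) * G (h a)) ^+ 2 <=
  #|I|%:R * m%:R * \sum_(0 <= k < m) w k * (G k - G k.+1) ^+ 2.
Proof.
move=> hm w0 wuni w1.
set T := \sum_(0 <= k < m) _.
have T0 : 0 <= T by apply: sumr_ge0 => k _; rewrite mulr_ge0 ?sqr_ge0.
have pair i j : (i <= j)%N -> (j <= m)%N ->
    w i * w j * (G i - G j) ^+ 2 <= (w i + w j) * (m%:R * T).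
  move=> ij jm; have wij0 : 0 <= w i * w j by rewrite mulr_ge0.
  apply: le_trans (ler_wpM2l wij0 (sum_telescope_sqr G ij jm)) _.
  rewrite mulrCA [leRHS]mulrCA ler_wpM2l //.
  have sum_ge0 p q : 0 <= \sum_(p <= k < q) w k * (G k - G k.+1) ^+ 2.
    by apply: sumr_ge0 => k _; rewrite mulr_ge0 ?sqr_ge0.
  have leT : \sum_(i <= k < j) w k * (G k - G k.+1) ^+ 2 <= T.
    rewrite /T (@big_cat_nat _ _ _ j 0%N m) // (@big_cat_nat _ _ _ i 0%N j) //=.
    by have := sum_ge0 0%N i; have := sum_ge0 j m; lra.
  apply: le_trans (ler_wpM2l (addr_ge0 (w0 i) (w0 j)) leT).
  rewrite mulr_sumr [leRHS]mulr_sumr big_seq [leRHS]big_seq; apply: ler_sum => k.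
  rewrite mem_index_iota => /andP [ik kj].
  rewrite [leRHS]mulrA ler_wpM2r ?sqr_ge0 //.
  have := wuni i j k ik (ltnW kj) jm.
  have := w0 i; have := w0 j; have := w0 k.
  rewrite ge_min => wk wj wi /orP [le_k|le_k]; nra.
have tot : \sum_a \sum_b w (h a) * w (h b) * (G (h a) - G (h b)) ^+ 2 <=
           2 * (#|I|%:R * m%:R * T).
  apply: (@le_trans _ _ (\sum_a \sum_b (w (h a) + w (h b)) * (m%:R * T))).
    apply: ler_sum => a _; apply: ler_sum => b _.
    have [ab|/ltnW ba] := leqP (h a) (h b); first exact: pair.
    rewrite [w (h a) * _]mulrC [w (h a) + _]addrC -[G (h a) - _]opprB sqrrN.
    exact: pair.
  under eq_bigr do rewrite -mulr_suml big_split /= sumr_const w1.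
  rewrite -mulr_suml big_split /= sumr_const sumrMnl w1.
  by rewrite le_eqVlt; apply/orP; left; apply/eqP; ring.
move: tot; rewrite sum_pair_variance w1 mul1r ler_pM2l //.
Qed.

End PathPoincare.

(** * Unimodality from the ratios of consecutive weights *)

Section Unimodal.
Variables (R : realType) (m : nat) (t : R) (w : nat -> R).
Hypotheses (t0 : 0 < t) (w0 : forall j, (j <= m)%N -> 0 < w j).

Let r j : R := (m%:R - j%:R) / (m%:R + j%:R + 1) * t ^+ j.*2.+1.

Hypothesis wS : forall j, (j < m)%N -> w j.+1 = w j * r j.

Let r_gt0 j : (j < m)%N -> 0 < r j.
Proof.
move=> jm; rewrite mulr_gt0 ?exprn_gt0 // divr_gt0 ?subr_gt0 ?ltr_nat //.
by rewrite ltr_wpDl ?addr_ge0.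
Qed.

(** The ratio at -1 would be the inverse of r 0 by symmetry, so this is
    log-concavity of r at 0. *)
Lemma ratio_base : (1 < m)%N -> r 1 <= r 0 ^+ 3.
Proof.
move=> m1; rewrite /r /= subr0 addr0 expr1.
have : 2 <= m%:R :> R by rewrite ler_nat.
move: (m%:R : R) => x x2.
rewrite [leRHS]exprMn ler_wpM2r ?exprn_ge0 ?(ltW t0) //.
rewrite exprMn exprVn ler_pdivrMr; last lra.
rewrite mulrAC ler_pdivlMr; last by rewrite exprn_gt0; lra.
rewrite -subr_ge0 (_ : _ - _ = 2 * x + 1); last by ring.
lra.
Qed.

Lemma ratio_log_concave j : (j.+2 < m)%N -> r j.+2 * r j <= r j.+1 ^+ 2.
Proof.
move=> jm; rewrite /r.
have : j%:R + 3 <= m%:R :> R by rewrite -natrD ler_nat addn3.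
have : 0 <= j%:R :> R by [].
rewrite -[j.+2]addn2 -[j.+1]addn1 !natrD.
move: (m%:R : R) (j%:R : R) => x y y0 xy.
rewrite mulrACA -exprD [leRHS]exprMn -exprM.
rewrite (_ : _ + _ = (j + 1).*2.+1 * 2)%N; last lia.
rewrite ler_wpM2r ?exprn_ge0 ?(ltW t0) //.
rewrite mulrACA -invfM exprMn exprVn ler_pdivrMr; last by rewrite mulr_gt0 //; lra.
rewrite mulrAC ler_pdivlMr; last by rewrite exprn_gt0; lra.
rewrite -subr_ge0 (_ : _ - _ = (2 * x + 1) * (2 * y + 3)); last by ring.
by rewrite mulr_ge0 //; lra.
Qed.

(** A log-concave sequence keeps decreasing once it has decreased.  It starts to
    do so at the latest when it first drops to 1 or below: at 0 because of
    r 1 <= r 0 ^ 3, and later because it must cross the value 1. *)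
Lemma ratio_nonincreasing j : (j.+1 < m)%N -> r j <= 1 -> r j.+1 <= r j.
Proof.
elim: j => [|j IH] jm rj1.
  have r00 : 0 < r 0 by apply: r_gt0; apply: leq_ltn_trans jm.
  apply: le_trans (ratio_base jm) _.
  by rewrite exprS -[leRHS]mulr1 ler_pM2l // exprn_ile1 // (ltW r00).
have rj0 : 0 < r j by apply: r_gt0; lia.
have decr : r j.+1 <= r j.
  have [rj|rj] := lerP (r j) 1; first by apply: IH => //; lia.
  exact: ltW (le_lt_trans rj1 rj).
rewrite -(ler_pM2r rj0); apply: le_trans (ratio_log_concave jm) _.
by rewrite expr2 ler_pM2l // r_gt0; lia.
Qed.

Lemma ratio_le1 i j : (i <= j)%N -> (j < m)%N -> r i <= 1 -> r j <= 1.
Proof.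
move=> ij jm ri; move: ij jm; elim: j => [|j IH]; first by rewrite leqn0 => /eqP <-.
rewrite leq_eqVlt => /orP [/eqP <- //|ij] jm.
have rj1 : r j <= 1 by apply: IH; lia.
exact: le_trans (ratio_nonincreasing jm rj1) rj1.
Qed.

(** By the previous lemma w increases as long as r > 1 and never increases again
    afterwards. *)
Lemma unimodal i j k : (i <= k)%N -> (k <= j)%N -> (j <= m)%N ->
  Num.min (w i) (w j) <= w k.
Proof.
move=> ik kj jm; rewrite ge_min.
have [km|] := ltnP k m; last first.
  by move=> mk; rewrite (_ : k = j); [rewrite lexx orbT|lia].
have [rk|rk] := lerP (r k) 1; apply/orP; [right|left].
  move: kj jm; elim: j => [|j IH]; first by rewrite leqn0 => /eqP ->.
  rewrite leq_eqVlt => /orP [/eqP <- //|kj] jm.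
  apply: le_trans (IH _ _) => //; last lia.
  rewrite wS // -[leRHS]mulr1 ler_pM2l ?w0 ?(ltnW jm) //; exact: (ratio_le1 (kj : (k <= j)%N) jm rk).
have up l : (l <= k)%N -> 1 <= r l.
  move=> lk; rewrite leNgt; apply/negP => rl.
  by have := ratio_le1 lk km (ltW rl); rewrite leNgt rk.
elim: k ik {kj rk} km up => [|k IH]; first by rewrite leqn0 => /eqP ->.
rewrite leq_eqVlt => /orP [/eqP <- //|ik] km up.
have wk : w i <= w k by apply: IH => //; [lia|move=> l lk; apply: up; lia].
apply: le_trans wk _; rewrite wS ?(ltnW km) // -[leLHS]mulr1 ler_pM2l ?w0 ?up //; lia.
Qed.

End Unimodal.

(** * Levels and flips of spin configurations *)

Section Configurations.
Variable N : nat.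
Implicit Types x y : spins N.

(** Levels are indexed by the number of spins equal to 1 rather than by the
    magnetization, so that they run through 0, ..., N. *)
Definition plus x : nat := \sum_(i < N) x i.

Lemma plus_le x : (plus x <= N)%N.
Proof.
rewrite -[leqRHS]card_ord -sum1_card.
by apply: leq_sum => i _; case: (x i).
Qed.

Lemma mag_plus x : mag x = (plus x)%:Z *+ 2 - N%:Z.
Proof.
rewrite /mag /plus (eq_bigr (fun i => (x i : nat)%:Z *+ 2 - 1)); last first.
  by move=> i _; rewrite /spin; case: (x i).
rewrite sumrB sumrMnl sumr_const card_ord -(big_morph Posz PoszD (erefl _)).
by rewrite natz.
Qed.

Lemma flipK j : involutive (fun x => flip x j).
Proof. by move=> x; apply/ffunP => i; rewrite !ffunE; case: eqP => // _; rewrite negbK. Qed.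

Lemma neg_spinsK : involutive (@neg_spins N).
Proof. by move=> x; apply/ffunP => i; rewrite !ffunE negbK. Qed.

Lemma flip_at x j : flip x j j = ~~ x j.
Proof. by rewrite ffunE eqxx. Qed.

Lemma plus_flip x j : ~~ x j -> plus (flip x j) = (plus x).+1.
Proof.
move=> xj; rewrite /plus (bigD1 j) //= [in RHS](bigD1 j) //= flip_at xj (negPf xj).
rewrite add1n add0n; congr _.+1; apply: eq_bigr => i ij.
by rewrite ffunE (negPf ij).
Qed.

Lemma plus_neg x : plus (neg_spins x) = (N - plus x)%N.
Proof.
apply/eqP; rewrite -(eqn_add2r (plus x)) subnK ?plus_le // /plus -big_split /=.
rewrite (eq_bigr (fun=> 1%N)); last by move=> i _; rewrite ffunE; case: (x i).
by rewrite sum1_card card_ord.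
Qed.

Lemma plus_mag x (a : nat) : (mag x == a%:Z *+ 2 - N%:Z) = (plus x == a).
Proof. by rewrite mag_plus; apply/eqP/eqP; lia. Qed.

Lemma mag_neg x : mag (neg_spins x) = - mag x.
Proof. by rewrite !mag_plus plus_neg; have := plus_le x; lia. Qed.

Lemma card_plus a : #|[pred x | plus x == a]| = 'C(N, a).
Proof.
have := card_draws 'I_N a; rewrite card_ord => <-.
pose h (A : {set 'I_N}) : spins N := [ffun i => i \in A].
have hinj : injective h.
  by move=> A B /ffunP AB; apply/setP => i; have := AB i; rewrite !ffunE.
have hplus A : plus (h A) = #|A|.
  by rewrite /plus -sum1_card [RHS]big_mkcond; apply: eq_bigr => i _; rewrite ffunE; case: (i \in A).
rewrite -(card_imset _ hinj); apply: eq_card => x; rewrite !inE.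
apply/idP/imsetP => [xa|[A Aa ->]]; last by rewrite hplus; rewrite inE in Aa.
have xE : x = h [set i | x i] by apply/ffunP => i; rewrite ffunE inE.
by exists [set i | x i] => //; rewrite inE -hplus -xE.
Qed.

End Configurations.

Section LevelSums.
Variables (R : realType) (N : nat).
Implicit Types (x y : spins N) (f : spins N -> R).

Definition level_mean f (a : nat) : R := (\sum_(x | plus x == a) f x) / 'C(N, a)%:R.

Lemma bin_neq0 a : (a <= N)%N -> 'C(N, a)%:R != 0 :> R.
Proof. by move=> aN; rewrite pnatr_eq0 -lt0n bin_gt0. Qed.

Lemma level_meanE f a : (a <= N)%N ->
  \sum_(x | plus x == a) f x = 'C(N, a)%:R * level_mean f a.
Proof. by move=> aN; rewrite /level_mean mulrC divfK // bin_neq0. Qed.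

Lemma sum_by_level (F : spins N -> R) :
  \sum_x F x = \sum_(a < N.+1) \sum_(x | plus x == a) F x.
Proof.
rewrite (partition_big (fun x => inord (plus x) : 'I_N.+1) predT) //=.
apply: eq_bigr => a _; apply: eq_bigl => x.
by rewrite -val_eqE /= inordK // ltnS plus_le.
Qed.

(** Flips between the levels a and a + 1 form a biregular bipartite graph: N - a
    edges leave each configuration of level a, and a + 1 edges arrive at each
    configuration of level a + 1.  The next two lemmas compute the two marginals
    of the uniform measure on its edges. *)
Lemma sum_up_flips a (F : spins N -> R) :
  \sum_(x | plus x == a) \sum_(j | ~~ x j) F x =
    (N - a)%:R * \sum_(x | plus x == a) F x.
Proof.
rewrite mulr_sumr; apply: eq_bigr => x /eqP xa.
rewrite sumr_const -[_ *+ #|_|]mulr_natl; congr (_%:R * _).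
rewrite -xa -plus_neg /plus -sum1_card big_mkcond; apply: eq_bigr => j _.
by rewrite ffunE unfold_in; case: (x j).
Qed.

Lemma sum_up_flips_target a (F : spins N -> R) :
  \sum_(x | plus x == a) \sum_(j | ~~ x j) F (flip x j) =
    a.+1%:R * \sum_(x | plus x == a.+1) F x.
Proof.
rewrite (exchange_big_dep predT) //= mulr_sumr.
transitivity (\sum_j \sum_(y | (plus y == a.+1) && y j) F y).
  apply: eq_bigr => j _; rewrite [RHS](reindex_inj (inv_inj (@flipK N j))) /=.
  apply: eq_bigl => x; rewrite flip_at.
  by case xj: (x j); rewrite ?andbF ?andbT //= plus_flip ?xj.
rewrite (exchange_big_dep (fun y : spins N => plus y == a.+1)) /=; last by move=> j y _ /andP[].
apply: eq_bigr => y ya; rewrite ya /= sumr_const -[_ *+ #|_|]mulr_natl; congr (_%:R * _).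
rewrite -(eqP ya) /plus -sum1_card big_mkcond; apply: eq_bigr => j _.
by rewrite -topredE /=; case: (y j).
Qed.

Lemma sum_flips_sym (G : spins N -> spins N -> R) : (forall x y, G x y = G y x) ->
  \sum_(x : spins N) \sum_j G x (flip x j) = 2 * \sum_(x : spins N) \sum_(j | ~~ x j) G x (flip x j).
Proof.
move=> Gsym.
have -> : \sum_(x : spins N) \sum_j G x (flip x j) =
    \sum_(x : spins N) \sum_(j | x j) G x (flip x j) + \sum_(x : spins N) \sum_(j | ~~ x j) G x (flip x j).
  by rewrite -big_split /=; apply: eq_bigr => x _; rewrite (bigID (fun j => x j)).
rewrite mulr2n mulrDl mul1r; congr (_ + _).
rewrite (exchange_big_dep predT) //= [RHS](exchange_big_dep predT) //=.
apply: eq_bigr => j _; rewrite (reindex_inj (inv_inj (@flipK N j))) /=.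
by apply: eq_big => [x|x _]; rewrite ?flip_at // flipK Gsym.
Qed.

(** Cauchy-Schwarz over the edges between two levels.  By biregularity the mean
    over the edges of f at either end is the mean of f on that level, so that
    passing from f to its level means does not increase the energy of flips. *)
Lemma up_flips_energy f a : (a < N)%N ->
  ('C(N, a) * (N - a))%:R * (level_mean f a - level_mean f a.+1) ^+ 2 <=
  \sum_(x | plus x == a) \sum_(j | ~~ x j) (f x - f (flip x j)) ^+ 2.
Proof.
move=> aN; set e := ('C(N, a) * (N - a))%N.
have e0 : 0 < e%:R :> R by rewrite ltr0n muln_gt0 subn_gt0 aN bin_gt0 ltnW.
pose P := [pred p : spins N * 'I_N | (plus p.1 == a) && ~~ p.1 p.2].
have pairE (F : spins N -> 'I_N -> R) :
    \sum_(x | plus x == a) \sum_(j | ~~ x j) F x j = \sum_(p | P p) F p.1 p.2.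
  by rewrite pair_big_dep.
have cardP : #|P|%:R = e%:R :> R.
  rewrite -sumr_const -(pairE (fun _ _ => 1)) (sum_up_flips a (fun=> 1)) sumr_const.
  by rewrite card_plus /e natrM mulrC.
have total : \sum_(p | P p) (f p.1 - f (flip p.1 p.2)) =
    e%:R * (level_mean f a - level_mean f a.+1).
  rewrite -(pairE (fun x j => f x - f (flip x j))).
  under eq_bigr do rewrite sumrB.
  rewrite sumrB sum_up_flips sum_up_flips_target !level_meanE ?(ltnW aN) //.
  rewrite [a.+1%:R * _]mulrA -natrM mul_bin_left /e natrM mulnC natrM; ring.
have := sqr_sum_le_card P (fun p => f p.1 - f (flip p.1 p.2)).
rewrite total cardP -(pairE (fun x j => (f x - f (flip x j)) ^+ 2)).
by rewrite exprMn expr2 -mulrA ler_pM2l.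
Qed.

Lemma level_mean_sqr_le f a : (a <= N)%N ->
  'C(N, a)%:R * level_mean f a ^+ 2 <= \sum_(x | plus x == a) f x ^+ 2.
Proof.
move=> aN; have c0 : 0 < 'C(N, a)%:R :> R by rewrite ltr0n bin_gt0.
have := sqr_sum_le_card [pred x | plus x == a] f.
by rewrite /= level_meanE // card_plus exprMn expr2 -mulrA ler_pM2l.
Qed.

Lemma neg_energy f a : (a <= N)%N ->
  'C(N, a)%:R * (level_mean f a - level_mean f (N - a)%N) ^+ 2 <=
  \sum_(x | plus x == a) (f x - f (neg_spins x)) ^+ 2.
Proof.
move=> aN.
have c0 : 0 < 'C(N, a)%:R :> R by rewrite ltr0n bin_gt0.
have total : \sum_(x | plus x == a) (f x - f (neg_spins x)) =
    'C(N, a)%:R * (level_mean f a - level_mean f (N - a)%N).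
  rewrite sumrB level_meanE // mulrBr; congr (_ - _).
  rewrite -bin_sub // -level_meanE ?leq_subr //.
  rewrite [RHS](reindex_inj (inv_inj (@neg_spinsK N))) /=; apply: eq_bigl => x.
  by rewrite plus_neg; have := plus_le x; lia.
have := sqr_sum_le_card [pred x | plus x == a] (fun x => f x - f (neg_spins x)).
by rewrite /= total card_plus exprMn expr2 -mulrA ler_pM2l.
Qed.

End LevelSums.

(** * Chains on a level *)

Section Extension.
Variables (R : realType) (N : nat) (s : int) (L : kernel R (level N s)).
Hypotheses (Lmarkov : markov L) (Lsym : symmetric_kernel L).
Implicit Types (x y : spins N) (f : spins N -> R).

Lemma sum_level (F : spins N -> R) :
  \sum_(x | mag x == s) F x = \sum_(u : level N s) F (val u).
Proof.
rewrite (reindex_omap (op := +%R) (val : level N s -> spins N) insub) => [|x xs].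
  by apply: eq_bigl => u; rewrite valK eqxx (valP u).
by rewrite insubT.
Qed.

Lemma card_level a : (forall x, (mag x == s) = (plus x == a)) ->
  #|{: level N s}| = 'C(N, a).
Proof.
move=> ma; rewrite card_sig -card_plus; apply: eq_card => x.
by rewrite !inE ma.
Qed.

Lemma extend0_val (u v : level N s) : extend0 L (val u) (val v) = L u v.
Proof. by rewrite /extend0 !valK. Qed.

Lemma extend0_notin x y : mag y != s -> extend0 L x y = 0.
Proof.
rewrite /extend0 => ys; case: insub => // u.
by case: insubP => // v /eqP yv; rewrite yv eqxx in ys.
Qed.

Lemma extend0_sym x y : extend0 L x y = extend0 L y x.
Proof. by rewrite /extend0; case: (insub x) (insub y) => [u|] [v|]. Qed.

Lemma extend0_ge0 x y : 0 <= extend0 L x y.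
Proof. by rewrite /extend0; case: insub => // u; case: insub => // v; case: Lmarkov. Qed.

Lemma sum_extend0 x (F : spins N -> R) :
  \sum_y extend0 L x y * F y = \sum_(y | mag y == s) extend0 L x y * F y.
Proof.
rewrite [RHS]big_mkcond; apply: eq_bigr => y _.
by case: ifPn => // /extend0_notin ->; rewrite mul0r.
Qed.

Lemma extend0_row x : mag x == s -> \sum_y extend0 L x y = 1.
Proof.
move=> xs; under eq_bigr do rewrite -[extend0 _ _ _]mulr1.
rewrite (sum_extend0 x (fun=> 1)) (sum_level (fun y => extend0 L x y * 1)).
have [_ L1] := Lmarkov; rewrite -[RHS](L1 (Sub x xs)).
by apply: eq_bigr => v _; rewrite mulr1 -extend0_val SubK.
Qed.

Lemma sum_extend0_level (F : spins N -> spins N -> R) :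
  \sum_(x | mag x == s) \sum_y extend0 L x y * F x y =
  \sum_(u : level N s) \sum_(v : level N s) L u v * F (val u) (val v).
Proof.
rewrite sum_level; apply: eq_bigr => u _.
rewrite sum_extend0 (sum_level (fun y => extend0 L (val u) y * F (val u) y)).
by apply: eq_bigr => v _; rewrite extend0_val.
Qed.

Lemma level_poincare f a : (a <= N)%N -> (forall x, (mag x == s) = (plus x == a)) ->
  2 * gap L * (\sum_(x | plus x == a) f x ^+ 2 -
               'C(N, a)%:R * level_mean f a ^+ 2) <=
  \sum_(x | plus x == a) \sum_y extend0 L x y * (f x - f y) ^+ 2.
Proof.
move=> aN ma; have eqs (F : spins N -> R) : \sum_(x | plus x == a) F x = \sum_(x | mag x == s) F x.
  by apply: eq_bigl => x; rewrite ma.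
have c0 := bin_neq0 R aN.
have -> : 'C(N, a)%:R * level_mean f a ^+ 2 =
    (\sum_(u : level N s) f (val u)) ^+ 2 / #|{: level N s}|%:R.
  by rewrite (card_level ma) -sum_level -eqs level_meanE //; field.
rewrite !eqs sum_extend0_level (sum_level (fun x => f x ^+ 2)).
apply: (gap_poincare Lmarkov Lsym); by rewrite (card_level ma) bin_gt0.
Qed.

Lemma level_poincare_plus f a : (a <= N)%N -> (forall x, (mag x == s) = (plus x == a)) ->
  2 * gap L * (\sum_(x | plus x == a) f x ^+ 2) <=
  \sum_(x | plus x == a) \sum_y extend0 L x y * (f x + f y) ^+ 2.
Proof.
move=> aN ma; have eqs (F : spins N -> R) : \sum_(x | plus x == a) F x = \sum_(x | mag x == s) F x.
  by apply: eq_bigl => x; rewrite ma.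
rewrite !eqs sum_extend0_level (sum_level (fun x => f x ^+ 2)).
apply: (gap_poincare_plus Lmarkov Lsym); by rewrite (card_level ma) bin_gt0.
Qed.

End Extension.

(** * Weights of the levels *)

Section IsingWeights.
Variables (R : realType) (m : nat) (beta : R).
Hypotheses (m0 : (0 < m)%N) (beta0 : 0 < beta).
Local Notation N := (m + m)%N.
Implicit Types (x y : spins N) (a j : nat).

Definition site_weight a : R :=
  expR (beta * (a%:R *+ 2 - N%:R) ^+ 2 / (2 * N%:R)) /
  \sum_(y : spins N) ising_weight beta y.

Definition level_weight a : R := 'C(N, a)%:R * site_weight a.

Let total_gt0 : 0 < \sum_(y : spins N) ising_weight beta y.
Proof.
rewrite (bigD1 [ffun=> true]) //= ltr_pwDl ?expR_gt0 //.
by apply: sumr_ge0 => y _; exact: expR_ge0.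
Qed.

Lemma site_weight_gt0 a : 0 < site_weight a.
Proof. by rewrite divr_gt0 ?expR_gt0. Qed.

Lemma isingE x : ising beta x = site_weight (plus x).
Proof.
have magE : (mag x)%:~R = (plus x)%:R *+ 2 - N%:R :> R.
  by rewrite mag_plus rmorphB rmorphMn.
by rewrite /ising /site_weight {1}/ising_weight magE.
Qed.

Lemma sum_ising : \sum_(x : spins N) ising beta x = 1.
Proof. by rewrite /ising -mulr_suml divff // gt_eqF. Qed.

Lemma level_weight_ge0 a : 0 <= level_weight a.
Proof. by rewrite mulr_ge0 // ltW // site_weight_gt0. Qed.

Lemma level_weight_gt0 a : (a <= N)%N -> 0 < level_weight a.
Proof. by move=> aN; rewrite mulr_gt0 ?site_weight_gt0 // ltr0n bin_gt0. Qed.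

Lemma sum_level_weight : \sum_(a < N.+1) level_weight a = 1.
Proof.
rewrite -sum_ising sum_by_level; apply: eq_bigr => a _.
rewrite (eq_bigr (fun=> site_weight a)) => [|x /eqP <-]; last exact: isingE.
by rewrite sumr_const card_plus -[_ *+ _]mulr_natl.
Qed.

(** The Gibbs weight depends on the magnetization through its square. *)
Lemma site_weight_sub a : (a <= N)%N -> site_weight (N - a) = site_weight a.
Proof.
move=> aN; rewrite /site_weight.
suff -> : ((N - a)%:R *+ 2 - N%:R) ^+ 2 = (a%:R *+ 2 - N%:R) ^+ 2 :> R by [].
by rewrite natrB //; ring.
Qed.

Lemma level_weight_sub a : (a <= N)%N -> level_weight (N - a) = level_weight a.
Proof. by move=> aN; rewrite /level_weight site_weight_sub // bin_sub. Qed.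

Lemma site_weight_mono a b :
  (a%:R *+ 2 - N%:R) ^+ 2 <= (b%:R *+ 2 - N%:R) ^+ 2 :> R ->
  site_weight a <= site_weight b.
Proof.
move=> ab; rewrite ler_pM2r ?invr_gt0 // ler_expR ler_pM2r ?ler_pM2l //.
by rewrite invr_gt0 mulr_gt0 // ltr0n addn_gt0 m0.
Qed.

(** Of the two levels a and a + 1, the one nearer to magnetization 0 has the
    smaller Gibbs weight, which is the minimum that appears here.  The number of
    flips is the size of that level times a degree, and the degree is at
    least 1. *)
Lemma level_weight_le_up_flow a : (a < N)%N ->
  level_weight (if (m <= a)%N then a else a.+1) <=
  ('C(N, a) * (N - a))%:R * Num.min (site_weight a) (site_weight a.+1).
Proof.
move=> aN; case: leqP => am.
  rewrite (min_idPl _).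
    rewrite natrM -mulrA [_ * site_weight a]mulrC mulrA -[leLHS]mulr1 ler_wpM2l //.
      exact: level_weight_ge0.
    by rewrite ler1n subn_gt0.
  apply: site_weight_mono; rewrite natrD.
  have : m%:R <= a%:R :> R by rewrite ler_nat.
  rewrite -[a.+1]addn1 natrD; move: (m%:R : R) (a%:R : R) => u v uv; nra.
rewrite (min_idPr _).
  rewrite mulnC -mul_bin_left natrM -mulrA -[leLHS]mul1r ler_wpM2r //.
    exact: level_weight_ge0.
  by rewrite ler1n.
apply: site_weight_mono; rewrite natrD.
have : a.+1%:R <= m%:R :> R by rewrite ler_nat.
rewrite -[a.+1]addn1 natrD; move: (m%:R : R) (a%:R : R) => u v uv; nra.
Qed.

Lemma level_weight_succ j : (j < m)%N ->
  level_weight (m + j.+1) = level_weight (m + j) *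
    ((m%:R - j%:R) / (m%:R + j%:R + 1) * expR (2 * beta / N%:R) ^+ j.*2.+1).
Proof.
move=> jm; rewrite /level_weight.
have nz : m%:R + j%:R + 1 != 0 :> R by rewrite gt_eqF // ltr_wpDl // addr_ge0.
have -> : 'C(N, m + j.+1)%:R = 'C(N, m + j)%:R * ((m%:R - j%:R) / (m%:R + j%:R + 1)) :> R.
  apply: (mulfI nz); have := mul_bin_left N (m + j).
  rewrite -addnS => /(congr1 (fun n => n%:R : R)).
  rewrite !natrM subnDl natrB ?(ltnW jm) // addnS -addn1 !natrD => ->.
  by field.
have -> : site_weight (m + j.+1) =
    site_weight (m + j) * expR (2 * beta / N%:R) ^+ j.*2.+1.
  rewrite /site_weight -expRM_natl [RHS]mulrAC -expRD.
  congr (_ / _); apply: congr1.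
  rewrite -[j.+1]addn1 -[j.*2.+1]addn1 -muln2 !(natrD, natrM).
  by field; rewrite -natrD pnatr_eq0 -lt0n addn_gt0 m0.
ring.
Qed.

Lemma level_weight_unimodal i j k : (i <= k)%N -> (k <= j)%N -> (j <= m)%N ->
  Num.min (level_weight (m + i)) (level_weight (m + j)) <= level_weight (m + k).
Proof.
apply: (@unimodal R m (expR (2 * beta / N%:R)) (fun j => level_weight (m + j))).
- exact: expR_gt0.
- by move=> l lm; apply: level_weight_gt0; rewrite leq_add2l.
- by move=> l lm; exact: level_weight_succ.
Qed.

End IsingWeights.

(** * The Metropolis chain of the mean field Ising model *)

Section Main.
Variables (R : realType) (m : nat) (beta p1 p2 : R).
Local Notation N := (m + m)%N.
Unset Implicit Arguments.
Variables (K0 : kernel R (level N 0)).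
Variables (Kp : forall i : nat, kernel R (level N i%:Z)).
Variables (Km : forall i : nat, kernel R (level N (- i%:Z))).
Set Implicit Arguments.
Hypotheses (m0 : (0 < m)%N) (beta0 : 0 < beta).
Hypotheses (p1_gt0 : 0 < p1) (p1_lt1 : p1 < 1) (p2_gt0 : 0 < p2) (p12 : p1 + p2 < 1).
Hypotheses (K0m : markov K0) (K0s : symmetric_kernel K0).
Hypothesis Kpm : forall i, level_index N i ->
  markov (Kp i) /\ symmetric_kernel (Kp i).
Hypothesis Kmm : forall i, level_index N i ->
  markov (Km i) /\ symmetric_kernel (Km i).
Implicit Types (x y : spins N) (f : spins N -> R).

Local Notation K := (proposal p1 p2 K0 Kp Km).
Local Notation pi := (ising beta : spins N -> R).

(** The part of the proposal that keeps the magnetization; the proposal is the sum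
    of this part, of single flips and of the sign change of all spins. *)
Definition within : kernel R (spins N) := fun x y =>
  if mag x == 0 then (1 - p1) * extend0 K0 x y
  else (1 - p1 - p2) *
    (if 0 < mag x then extend0 (Kp `|mag x|%N) x y else extend0 (Km `|mag x|%N) x y).

Lemma proposalE x y : K x y =
  p1 * K_E R x y + p2 * ((mag x != 0) && (y == neg_spins x))%:R + within x y.
Proof.
rewrite /proposal /within; case: ifP => _ //=.
by rewrite mulr0 addr0.
Qed.

Definition level_rate (a : nat) : R := if a == m then 1 - p1 else 1 - p1 - p2.

Lemma level_rate_ge0 a : 0 <= level_rate a.
Proof. by rewrite /level_rate; move: p1_lt1 p12; case: ifP => _; lra. Qed.

(** This hides the dependence of the types of the three families of chains on the
    level: on each level the proposal contains a symmetric chain L, at a rate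
    whose product with its gap is at least any c that bounds the corresponding
    products for all three families. *)
Lemma within_level a : (a <= N)%N -> exists s (L : kernel R (level N s)),
  [/\ markov L, symmetric_kernel L,
      forall c, c <= (1 - p1) * gap K0 ->
        (forall i, level_index N i -> c <= (1 - p1 - p2) * gap (Kp i) /\
                                      c <= (1 - p1 - p2) * gap (Km i)) ->
        c <= level_rate a * gap L &
      (forall x, (mag x == s) = (plus x == a)) /\
      forall x y, plus x = a -> within x y = level_rate a * extend0 L x y].
Proof.
move=> aN; rewrite /level_rate; have [am|am|am] := ltngtP a m.
- pose i := (N - a.*2)%N.
  have ii : level_index N i by rewrite /level_index /i; lia.
  have [Lm Ls] := Kmm ii.
  exists (- i%:Z), (Km i); split=> //; first by move=> c _ /(_ i ii) [].
  have ma x : (mag x == - i%:Z) = (plus x == a).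
    by rewrite -plus_mag; congr (_ == _); rewrite /i; lia.
  split=> // x y xa; have /eqP mx : mag x == - i%:Z by rewrite ma xa.
  rewrite /within mx; have -> : (- i%:Z == 0) = false by rewrite /i; lia.
  have -> : (0 < - i%:Z) = false by rewrite /i; lia.
  by rewrite abszN absz_nat.
- pose i := (a.*2 - N)%N.
  have ii : level_index N i by rewrite /level_index /i; lia.
  have [Lm Ls] := Kpm ii.
  exists i%:Z, (Kp i); split=> //; first by move=> c _ /(_ i ii) [].
  have ma x : (mag x == i%:Z) = (plus x == a).
    by rewrite -plus_mag; congr (_ == _); rewrite /i; lia.
  split=> // x y xa; have /eqP mx : mag x == i%:Z by rewrite ma xa.
  rewrite /within mx; have -> : (i%:Z == 0) = false by rewrite /i; lia.
  by have -> : (0 < i%:Z) by rewrite /i; lia.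
exists 0, K0; split=> //.
have ma x : (mag x == 0) = (plus x == a).
  by rewrite -plus_mag; congr (_ == _); lia.
by split=> // x y xa; rewrite /within ma xa eqxx.
Qed.

Lemma within_ge0 x y : 0 <= within x y.
Proof.
have [s [L [Lm Ls _ [ma wE]]]] := within_level (plus_le x).
by rewrite wE // mulr_ge0 ?level_rate_ge0 // extend0_ge0.
Qed.

Lemma within_notin x y : plus x != plus y -> within x y = 0.
Proof.
have [s [L [Lm Ls _ [ma wE]]]] := within_level (plus_le x) => xy.
by rewrite wE // extend0_notin ?mulr0 // ma eq_sym.
Qed.

Lemma within_sym x y : within x y = within y x.
Proof.
have [xy|xy] := eqVneq (plus x) (plus y); last by rewrite !within_notin // eq_sym.
have [s [L [Lm Ls _ [ma wE]]]] := within_level (plus_le x).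
by rewrite !wE // extend0_sym.
Qed.

Lemma level_rateE x : level_rate (plus x) = if mag x == 0 then 1 - p1 else 1 - p1 - p2.
Proof. by rewrite /level_rate mag_plus; congr (if _ then _ else _); lia. Qed.

Lemma within_row x : \sum_y within x y = level_rate (plus x).
Proof.
have [s [L [Lm Ls _ [ma wE]]]] := within_level (plus_le x).
under eq_bigr do rewrite wE //.
by rewrite -mulr_sumr extend0_row ?mulr1 // ma.
Qed.

Lemma K_E_sum x (F : spins N -> R) :
  \sum_y K_E R x y * F y = N%:R^-1 * \sum_j F (flip x j).
Proof.
rewrite /K_E mulr_sumr; under eq_bigr do rewrite -mulrA mulr_suml mulr_sumr.
rewrite exchange_big /=; apply: eq_bigr => j _.
rewrite (bigD1 (flip x j)) //= eqxx mul1r big1 ?addr0 // => y /negPf ->.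
by rewrite mul0r mulr0.
Qed.

Lemma flip_neg_sum x (b : bool) (F : spins N -> R) :
  \sum_y (b && (y == neg_spins x))%:R * F y = b%:R * F (neg_spins x).
Proof.
rewrite (bigD1 (neg_spins x)) //= eqxx andbT big1 ?addr0 // => y /negPf ->.
by rewrite andbF mul0r.
Qed.

Lemma proposal_markov : markov K.
Proof.
split=> [x y|x].
  rewrite proposalE !addr_ge0 ?within_ge0 ?mulr_ge0 ?(ltW p1_gt0) ?(ltW p2_gt0) //.
  by rewrite invr_ge0.
  by apply: sumr_ge0 => j _; rewrite ler0n.
transitivity (p1 * (\sum_y K_E R x y) +
    p2 * (\sum_y ((mag x != 0) && (y == neg_spins x))%:R) + \sum_y within x y).
  by rewrite !mulr_sumr -!big_split; apply: eq_bigr => y _; exact: proposalE.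
rewrite within_row level_rateE.
have -> : \sum_y K_E R x y = 1.
  transitivity (\sum_y K_E R x y * 1); first by apply: eq_bigr => y _; rewrite mulr1.
  rewrite (K_E_sum x (fun=> 1)) sumr_const card_ord mulVf //.
  by rewrite pnatr_eq0 -lt0n addn_gt0 m0.
have -> : \sum_y ((mag x != 0) && (y == neg_spins x))%:R = (mag x != 0)%:R :> R.
  rewrite -[RHS]mulr1 -(flip_neg_sum x _ (fun=> 1)).
  by apply: eq_bigr => y _; rewrite mulr1.
by case: eqP => _ /=; ring.
Qed.

Lemma proposal_sym : symmetric_kernel K.
Proof.
move=> x y; rewrite !proposalE within_sym; congr (_ * _ + _ * _ + _).
  rewrite /K_E; congr (_ * _); apply: eq_bigr => j _; congr (_%:R).
  by congr (nat_of_bool _); apply/eqP/eqP => ->; rewrite flipK.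
congr (_%:R); congr (nat_of_bool _).
apply/andP/andP => -[h /eqP e]; rewrite e mag_neg oppr_eq0 ?neg_spinsK ?eqxx //.
Qed.

Local Notation W := (level_weight m beta).
Local Notation omega := (site_weight m beta).
Local Notation G f k := ((level_mean f (m + k)%N + level_mean f (m - k)%N) / 2).

Let pi_gt0 x : 0 < pi x. Proof. by rewrite isingE site_weight_gt0. Qed.

Let minpi_ge0 x y : 0 <= Num.min (pi x) (pi y).
Proof. by rewrite le_min !ltW. Qed.

Lemma flip_form f :
  2 / N%:R * \sum_(a < N) W (if (m <= a)%N then a : nat else a.+1) *
     (level_mean f a - level_mean f a.+1) ^+ 2 <=
  \sum_x \sum_y K_E R x y * (Num.min (pi x) (pi y) * (f x - f y) ^+ 2).
Proof.
pose E x y := Num.min (pi x) (pi y) * (f x - f y) ^+ 2.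
have E0 x y : 0 <= E x y by rewrite mulr_ge0 ?sqr_ge0.
have Esym x y : E x y = E y x by rewrite /E minC -[f x - _]opprB sqrrN.
have -> : \sum_x \sum_y K_E R x y * E x y = N%:R^-1 * \sum_(x : spins N) \sum_j E x (flip x j).
  by rewrite mulr_sumr; apply: eq_bigr => x _; rewrite K_E_sum.
rewrite sum_flips_sym // mulrA [_^-1 * 2]mulrC ler_wpM2l ?divr_ge0 //.
rewrite sum_by_level big_ord_recr /= -[leLHS]addr0 lerD //; last first.
  by apply: sumr_ge0 => x _; apply: sumr_ge0.
apply: ler_sum => a _.
apply: le_trans (ler_wpM2r (sqr_ge0 _) (level_weight_le_up_flow m0 beta0 (ltn_ord a))) _.
rewrite mulrAC.
apply: le_trans (ler_wpM2r _ (up_flips_energy f (ltn_ord a))) _.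
  by rewrite le_min !ltW // site_weight_gt0.
rewrite mulr_suml; apply: ler_sum => x /eqP xa.
rewrite mulr_suml; apply: ler_sum => j xj.
by rewrite /E !isingE plus_flip // xa mulrC.
Qed.

(** The two halves of the range of levels carry the same weights, and by convexity
    of the square the average G of the level means at m + k and m - k has no
    more energy than both halves together. *)
Lemma flip_fold f :
  2 * \sum_(0 <= k < m) W (m + k) * (G f k - G f k.+1) ^+ 2 <=
  \sum_(a < N) W (if (m <= a)%N then a : nat else a.+1) *
     (level_mean f a - level_mean f a.+1) ^+ 2.
Proof.
rewrite big_split_ord /= [X in X + _](reindex_inj rev_ord_inj) /= -big_split /=.
rewrite big_mkord mulr_sumr; apply: ler_sum => k _.
have km := ltn_ord k.
have -> : (m <= m - k.+1)%N = false by lia.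
rewrite leq_addr.
have -> : (m - k.+1).+1 = (m - k)%N by lia.
have -> : W (m - k) = W (m + k).
  rewrite -level_weight_sub; first by congr W; lia.
  by lia.
rewrite -addnS -mulrDr mulrCA ler_wpM2l ?level_weight_ge0 //.
move: (level_mean f (m + k)) (level_mean f (m - k)) (level_mean f (m + k.+1))
  (level_mean f (m - k.+1)) => u v u' v'.
rewrite -subr_ge0.
have -> : (v' - v) ^+ 2 + (u - u') ^+ 2 - 2 * ((u + v) / 2 - (u' + v') / 2) ^+ 2 =
  (u - u' - v + v') ^+ 2 / 2 by field.
by rewrite divr_ge0 ?sqr_ge0.
Qed.

Lemma neg_form f :
  \sum_(a < N.+1) W a * (level_mean f a - level_mean f (N - a)%N) ^+ 2 <=
  \sum_x \sum_y ((mag x != 0) && (y == neg_spins x))%:R *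
     (Num.min (pi x) (pi y) * (f x - f y) ^+ 2).
Proof.
rewrite [leRHS]sum_by_level; apply: ler_sum => a _; have aN : (a <= N)%N by rewrite -ltnS.
have [am|am] := eqVneq (a : nat) m.
  rewrite (_ : (N - a)%N = a); last lia.
  rewrite subrr expr0n mulr0; apply: sumr_ge0 => x _; apply: sumr_ge0 => y _.
  by rewrite mulr_ge0 ?ler0n // mulr_ge0 ?sqr_ge0.
rewrite /level_weight mulrAC mulrC.
apply: le_trans (ler_wpM2l _ (neg_energy f aN)) _; first by rewrite ltW ?site_weight_gt0.
rewrite mulr_sumr; apply: ler_sum => x /eqP xa.
rewrite (flip_neg_sum x _ (fun y => Num.min (pi x) (pi y) * (f x - f y) ^+ 2)).
have -> : mag x != 0 by rewrite mag_plus; lia.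
by rewrite mul1r !isingE plus_neg xa site_weight_sub // minxx.
Qed.

Section WithinRate.
Variable c : R.
Hypothesis c_le_K0 : c <= (1 - p1) * gap K0.
Hypothesis c_le : forall i, level_index N i ->
  c <= (1 - p1 - p2) * gap (Kp i) /\ c <= (1 - p1 - p2) * gap (Km i).

(** Levels carry a constant Gibbs weight, so an inequality for the chain of each
    level sums up to one for the whole proposal. *)
Lemma within_form (E : spins N -> spins N -> R) (V : nat -> R) :
  (forall a t (L : kernel R (level N t)), (a <= N)%N -> markov L -> symmetric_kernel L ->
     (forall x, (mag x == t) = (plus x == a)) ->
     0 <= V a /\ 2 * gap L * V a <=
     \sum_(x | plus x == a) \sum_y extend0 L x y * E x y) ->
  2 * c * \sum_(a < N.+1) omega a * V a <=
  \sum_x \sum_y within x y * (Num.min (pi x) (pi y) * E x y).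
Proof.
move=> levelV; rewrite mulr_sumr sum_by_level; apply: ler_sum => a _.
have aN : (a <= N)%N by rewrite -ltnS.
have [t [L [Lm Ls crate [ma wE]]]] := within_level aN.
have [V0 gapV] := levelV a t L aN Lm Ls ma.
have -> : \sum_(x | plus x == a) \sum_y within x y *
      (Num.min (pi x) (pi y) * E x y) =
    omega a * (level_rate a *
      \sum_(x | plus x == a) \sum_y extend0 L x y * E x y).
  rewrite !mulr_sumr; apply: eq_bigr => x /eqP xa; rewrite !mulr_sumr.
  apply: eq_bigr => y _; rewrite wE //.
  have [ya|ya] := eqVneq (mag y) t; last by rewrite extend0_notin //; ring.
  have /eqP ya' : plus y == a by rewrite -ma ya.
  by rewrite !isingE xa ya' minxx; ring.
rewrite mulrCA ler_wpM2l ?(ltW (site_weight_gt0 m beta a)) //.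
apply: le_trans _ (ler_wpM2l (level_rate_ge0 a) gapV).
have := ler_wpM2r V0 (crate c c_le_K0 c_le); lra.
Qed.

Lemma within_sub_form f :
  2 * c * \sum_(a < N.+1) omega a *
    (\sum_(x | plus x == a) f x ^+ 2 - 'C(N, a)%:R * level_mean f a ^+ 2) <=
  \sum_x \sum_y within x y * (Num.min (pi x) (pi y) * (f x - f y) ^+ 2).
Proof.
apply: (within_form (E := fun x y => (f x - f y) ^+ 2) (V := fun a =>
  \sum_(x | plus x == a) f x ^+ 2 - 'C(N, a)%:R * level_mean f a ^+ 2)).
move=> a t L aN Lm Ls ma; split; last exact: level_poincare.
by rewrite subr_ge0 level_mean_sqr_le.
Qed.

Lemma within_plus_form f :
  2 * c * \sum_x pi x * f x ^+ 2 <=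
  \sum_x \sum_y within x y * (Num.min (pi x) (pi y) * (f x + f y) ^+ 2).
Proof.
rewrite [X in _ * X <= _]sum_by_level.
under [X in _ * X <= _]eq_bigr => a _.
  under eq_bigr => x /eqP xa do rewrite isingE xa.
  rewrite -mulr_sumr.
  over.
apply: (within_form (E := fun x y => (f x + f y) ^+ 2) (V := fun a =>
  \sum_(x | plus x == a) f x ^+ 2)).
move=> a t L aN Lm Ls ma; split; last exact: level_poincare_plus.
by apply: sumr_ge0 => x _; exact: sqr_ge0.
Qed.

End WithinRate.

(** Variance inside the levels, plus variance of the level means.  The latter is
    split again, into the part that is odd under exchanging the levels a and
    N - a and the variance of the even part G, which is bounded by the path
    inequality on the vertices 0, ..., m. *)
Lemma variance_split f :
  \sum_x pi x * f x ^+ 2 - (\sum_x pi x * f x) ^+ 2 <=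
  \sum_(a < N.+1) omega a *
    (\sum_(x | plus x == a) f x ^+ 2 - 'C(N, a)%:R * level_mean f a ^+ 2) +
  (\sum_(a < N.+1) W a * (level_mean f a - level_mean f (N - a)%N) ^+ 2) / 4 +
  (N.+1)%:R * m%:R * \sum_(0 <= k < m) W (m + k) * (G f k - G f k.+1) ^+ 2.
Proof.
pose u a := level_mean f a.
have sum_pi (F : spins N -> R) : \sum_x pi x * F x =
    \sum_(a < N.+1) omega a * \sum_(x | plus x == a) F x.
  rewrite sum_by_level; apply: eq_bigr => a _; rewrite mulr_sumr.
  by apply: eq_bigr => x /eqP xa; rewrite isingE xa.
have mean_pi : \sum_x pi x * f x = \sum_(a < N.+1) W a * u a.
  rewrite sum_pi; apply: eq_bigr => a _; rewrite level_meanE ?leq_ord //.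
  by rewrite /level_weight /u; ring.
have sqr_pi : \sum_x pi x * f x ^+ 2 = \sum_(a < N.+1) omega a *
      (\sum_(x | plus x == a) f x ^+ 2 - 'C(N, a)%:R * u a ^+ 2) +
    \sum_(a < N.+1) W a * u a ^+ 2.
  rewrite sum_pi -big_split; apply: eq_bigr => a _ /=.
  by rewrite /level_weight; ring.
pose h (a : 'I_N.+1) := ((a - m) + (m - a))%N.
have hm a : (h a <= m)%N by have := ltn_ord a; rewrite /h; lia.
have Wh a : W (m + h a) = W a.
  have [am|am] := leqP m a; first by congr W; rewrite /h; lia.
  by rewrite -level_weight_sub; [congr W|]; rewrite /h; lia.
have Gh (a : 'I_N.+1) : G f (h a) = (u a + u (N - a)%N) / 2.
  have aN := ltn_ord a; have [am|am] := leqP m a.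
    rewrite (_ : (m + h a)%N = a); last by rewrite /h; lia.
    by rewrite (_ : (m - h a)%N = (N - a)%N) //; rewrite /h; lia.
  rewrite (_ : (m + h a)%N = (N - a)%N); last by rewrite /h; lia.
  by rewrite (_ : (m - h a)%N = a) 1?addrC //; rewrite /h; lia.
have rev (F : nat -> R) : \sum_(a < N.+1) W a * F (N - a)%N = \sum_(a < N.+1) W a * F a.
  rewrite (reindex_inj rev_ord_inj) /=; apply: eq_bigr => a _.
  have aN := ltn_ord a; rewrite subSS level_weight_sub ?leq_ord //.
  by rewrite subKn // -ltnS.
have path := @path_poincare R 'I_N.+1 h m (fun k => W (m + k)) (fun k => G f k) hm
  (fun k => level_weight_ge0 m beta _) (@level_weight_unimodal R m beta m0).
rewrite /= in path.
have totW : \sum_a W (m + h a) = 1.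
  by rewrite -(sum_level_weight m beta); apply: eq_bigr => a _; rewrite Wh.
have {path} := path totW; rewrite card_ord.
under eq_bigr do rewrite Wh Gh.
under [X in _ - X ^+ 2]eq_bigr do rewrite Wh Gh.
rewrite mean_pi sqr_pi => path.
have mean_sym : \sum_(a < N.+1) W a * ((u a + u (N - a)%N) / 2) =
    \sum_(a < N.+1) W a * u a.
  transitivity ((\sum_(a < N.+1) W a * u a + \sum_(a < N.+1) W a * u (N - a)%N) / 2).
    by rewrite -big_split mulr_suml; apply: eq_bigr => a _ /=; ring.
  by rewrite rev; field.
have sqr_sym : \sum_(a < N.+1) W a * u a ^+ 2 =
    (\sum_(a < N.+1) W a * (u a - u (N - a)%N) ^+ 2) / 4 +
    \sum_(a < N.+1) W a * ((u a + u (N - a)%N) / 2) ^+ 2.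
  transitivity ((\sum_(a < N.+1) W a * u a ^+ 2 +
                 \sum_(a < N.+1) W a * u (N - a)%N ^+ 2) / 2).
    by rewrite (rev (fun a => u a ^+ 2)); field.
  rewrite -big_split !mulr_suml -big_split; apply: eq_bigr => a _ /=.
  by field.
rewrite mean_sym in path; rewrite sqr_sym -/(u _); lra.
Qed.

(** Each of the three parts of the variance is controlled by one part of the
    proposal: chains inside the levels, change of sign and single flips, in the
    order of the last four hypotheses.  The inequality for the smallest
    eigenvalue already follows from the chains inside the levels. *)
Lemma metropolis_ising_gap (c : R) : 0 <= c -> c <= 1 ->
  c <= (1 - p1) * gap K0 ->
  (forall i, level_index N i ->
    c <= (1 - p1 - p2) * gap (Kp i) /\ c <= (1 - p1 - p2) * gap (Km i)) ->
  c <= 2 * p2 -> c * (N.+1%:R * m%:R ^+ 2) <= p1 ->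
  c <= gap (metropolis pi K).
Proof.
move=> c0 c1 cK0 cK cp2 cp1.
have splitK (E : spins N -> spins N -> R) :
    \sum_x \sum_y K x y * Num.min (pi x) (pi y) * E x y =
    p1 * (\sum_x \sum_y K_E R x y * (Num.min (pi x) (pi y) * E x y)) +
    p2 * (\sum_x \sum_y ((mag x != 0) && (y == neg_spins x))%:R *
                         (Num.min (pi x) (pi y) * E x y)) +
    \sum_x \sum_y within x y * (Num.min (pi x) (pi y) * E x y).
  rewrite !mulr_sumr -!big_split; apply: eq_bigr => x _ /=.
  rewrite !mulr_sumr -!big_split; apply: eq_bigr => y _ /=.
  by rewrite proposalE; ring.
apply: metropolis_gap_ge => //.
- exact: sum_ising.
- exact: proposal_markov.
- exact: proposal_sym.
- move=> f; rewrite splitK.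
  have N0 : 0 <= 2 / N%:R :> R by rewrite divr_ge0.
  have c2 : 0 <= 2 * c by rewrite mulr_ge0.
  apply: le_trans (ler_wpM2l c2 (variance_split f)) _.
  have := within_sub_form cK0 cK f.
  have := ler_wpM2l (ltW p2_gt0) (neg_form f).
  have := ler_wpM2l (ltW p1_gt0) (le_trans (ler_wpM2l N0 (flip_fold f)) (flip_form f)).
  have : 0 <= \sum_(a < N.+1) W a * (level_mean f a - level_mean f (N - a)%N) ^+ 2.
    by apply: sumr_ge0 => a _; rewrite mulr_ge0 ?sqr_ge0 ?level_weight_ge0.
  have : 0 <= \sum_(0 <= k < m) W (m + k) * (G f k - G f k.+1) ^+ 2.
    by apply: sumr_ge0 => a _; rewrite mulr_ge0 ?sqr_ge0 ?level_weight_ge0.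
  set T := \sum_(0 <= k < m) _; set S := \sum_(a < N.+1) W a * _.
  set L := \sum_(a < N.+1) _.
  move: (\sum_x \sum_y K_E R x y * _) => E1.
  move: (\sum_x \sum_y (_ && _)%:R * _) => E2.
  move: (\sum_x \sum_y within x y * _) => E3 T0 S0 e1 e2 e3.
  have rate_T : 2 * c * (N.+1%:R * m%:R * T) <= p1 * (2 / N%:R * (2 * T)).
    have mR : 0 < m%:R :> R by rewrite ltr0n.
    have -> : p1 * (2 / N%:R * (2 * T)) = p1 * (2 * (T / m%:R)).
      by rewrite natrD; field; rewrite -natrD !pnatr_eq0 -!lt0n addn_gt0 m0.
    have -> : 2 * c * (N.+1%:R * m%:R * T) =
        c * (N.+1%:R * m%:R ^+ 2) * (2 * (T / m%:R)) by field; rewrite gt_eqF.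
    by rewrite ler_wpM2r // mulr_ge0 // divr_ge0.
  have rate_S : 2 * c * (S / 4) <= p2 * S.
    rewrite (_ : 2 * c * (S / 4) = c / 2 * S); last by field.
    by rewrite ler_wpM2r //; lra.
  by rewrite !mulrDr; lra.
move=> f; rewrite splitK.
have add_ge0 (Q : kernel R (spins N)) : (forall x y, 0 <= Q x y) ->
    0 <= \sum_x \sum_y Q x y * (Num.min (pi x) (pi y) * (f x + f y) ^+ 2).
  move=> Q0; apply: sumr_ge0 => x _; apply: sumr_ge0 => y _.
  by rewrite mulr_ge0 // mulr_ge0 ?sqr_ge0.
apply: le_trans (within_plus_form cK0 cK f) _; rewrite lerDr addr_ge0 //.
  rewrite mulr_ge0 ?(ltW p1_gt0) // add_ge0 // => x y.
  by rewrite mulr_ge0 ?invr_ge0 //; apply: sumr_ge0 => j _; rewrite ler0n.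
by rewrite mulr_ge0 ?(ltW p2_gt0) // add_ge0.
Qed.

End Main.

(** * Comparison of constants *)

Section Assembly.
Variable R : realType.

Lemma bigmin_le_mem (I : eqType) (r : seq I) (P : pred I) (F : I -> R) d i :
  i \in r -> P i -> \big[Num.min/d]_(j <- r | P j) F j <= F i.
Proof.
elim: r => [//|j r IH]; rewrite inE big_cons => /orP [/eqP <-|ir] Pi.
  by rewrite Pi ge_min lexx.
by case: ifP => _; rewrite ?ge_min IH ?orbT.
Qed.

Lemma level_zero m (x : spins (m + m)) : (mag x == 0) = (plus x == m).
Proof. by rewrite -plus_mag; congr (_ == _); lia. Qed.

Lemma level_pos m i (x : spins (m + m)) : level_index (m + m) i ->
  (mag x == i%:Z) = (plus x == m + i./2)%N.
Proof. by rewrite /level_index => ii; rewrite -plus_mag; congr (_ == _); lia. Qed.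

Lemma level_neg m i (x : spins (m + m)) : level_index (m + m) i ->
  (mag x == - i%:Z) = (plus x == m - i./2)%N.
Proof. by rewrite /level_index => ii; rewrite -plus_mag; congr (_ == _); lia. Qed.

(** The constant k * min(a, b) of the statement is compared with the conditions of
    metropolis_ising_gap; the last one holds because, for N = 2 m, the cube of
    N / 2 + 1 exceeds (N + 1) m ^ 2 / 2, and the others have a lot of room. *)
Lemma gap_bound (p1 p2 : R) (m : nat) (beta : R)
    (K0 : kernel R (level (m + m) 0))
    (Kp : forall i : nat, kernel R (level (m + m) i%:Z))
    (Km : forall i : nat, kernel R (level (m + m) (- i%:Z))) :
  0 < p1 -> 0 < p2 -> p1 + p2 < 1 -> (0 < m)%N -> 0 < beta ->
  markov K0 /\ symmetric_kernel K0 ->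
  (forall i, level_index (m + m) i -> markov (Kp i) /\ symmetric_kernel (Kp i)) ->
  (forall i, level_index (m + m) i -> markov (Km i) /\ symmetric_kernel (Km i)) ->
  p1 * p2 / 32 * (1 / ((m + m)%:R / 2 + 1) ^+ 3) *
    Num.min ((1 - p1) / p2 * gap K0) ((1 - p1 - p2) / 2 * min_gap Kp Km)
  <= gap (metropolis (ising beta) (proposal p1 p2 K0 Kp Km)).
Proof.
move=> p1_gt0 p2_gt0 p12 m0 beta0 [K0m K0s] Kpm Kmm.
have NN : level_index (m + m) (m + m) by rewrite /level_index; lia.
have g00 : 0 <= gap K0.
  by apply: gap_ge0 => //; rewrite (card_level (@level_zero m)) bin_gt0 leq_addl.
have gp0 i : level_index (m + m) i -> 0 <= gap (Kp i).
  move=> ii; have [? ?] := Kpm i ii; apply: gap_ge0 => //.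
  rewrite (card_level (fun x => level_pos x ii)) bin_gt0.
  by move: ii; rewrite /level_index; lia.
have gm0 i : level_index (m + m) i -> 0 <= gap (Km i).
  move=> ii; have [? ?] := Kmm i ii; apply: gap_ge0 => //.
  rewrite (card_level (fun x => level_neg x ii)) bin_gt0.
  by move: ii; rewrite /level_index; lia.
have mg0 : 0 <= min_gap Kp Km.
  rewrite /min_gap big_nat_cond; apply: (big_ind (fun v => 0 <= v)).
  - by rewrite le_min gp0 // gm0.
  - by move=> u v u0 v0; rewrite le_min u0.
  - by move=> i ii; rewrite le_min gp0 ?gm0 //; rewrite /level_index; lia.
have mg_le i : level_index (m + m) i ->
    min_gap Kp Km <= gap (Kp i) /\ min_gap Kp Km <= gap (Km i).
  move=> /and3P [i2 iN io].
  have : min_gap Kp Km <= Num.min (gap (Kp i)) (gap (Km i)).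
    by rewrite /min_gap bigmin_le_mem // mem_index_iota i2 ltnS.
  by rewrite le_min => /andP.
have mg1 : min_gap Kp Km <= 1 by apply: le_trans (mg_le _ NN).1 (gap_le1 _).
set n : R := (m + m)%:R / 2 + 1.
have nE : n = m%:R + 1 by rewrite /n natrD; field.
have mR : 1 <= m%:R :> R by rewrite ler1n.
set k := p1 * p2 / 32 * (1 / n ^+ 3).
have n1 : 1 <= n ^+ 3 by rewrite exprn_ege1 //; lra.
have k0 : 0 <= k by rewrite mulr_ge0 ?divr_ge0 ?mulr_ge0 //; lra.
have k1 : k <= p1 * p2 / 32.
  rewrite -[leRHS]mulr1 ler_wpM2l ?divr_ge0 ?mulr_ge0 //; try lra.
  by rewrite ler_pdivrMr ?mul1r //; lra.
set a := (1 - p1) / p2 * gap K0; set b := (1 - p1 - p2) / 2 * min_gap Kp Km.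
have a0 : 0 <= a by rewrite mulr_ge0 // divr_ge0 //; lra.
have b0 : 0 <= b by rewrite mulr_ge0 // divr_ge0 //; lra.
have b1 : b <= 1 by rewrite /b; nra.
have ca : k * Num.min a b <= k * a by rewrite ler_wpM2l // ge_min lexx.
have cb : k * Num.min a b <= k * b by rewrite ler_wpM2l // ge_min lexx orbT.
have p1p2 : p1 * p2 <= p2 by nra.
have kb : k * b <= k by rewrite -[leRHS]mulr1 ler_wpM2l.
have p1_lt1 : p1 < 1 by lra.
apply: metropolis_ising_gap => //.
- by rewrite mulr_ge0 // le_min a0.
- by nra.
- apply: le_trans ca _.
  rewrite /a mulrA ler_wpM2r // mulrCA -[leRHS]mulr1 ler_wpM2l //; first lra.
  by rewrite ler_pdivrMr //; nra.
- move=> i ii; have [gp gm] := mg_le i ii.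
  have kb' : k * b <= (1 - p1 - p2) * min_gap Kp Km.
    rewrite /b -mulrA mulrCA ler_wpM2l //; first lra.
    by rewrite mulrA -[leRHS]mul1r ler_wpM2r //; nra.
  by split; apply: le_trans cb (le_trans kb' _); rewrite ler_wpM2l //; lra.
- by nra.
apply: le_trans (ler_wpM2r _ (le_trans cb kb)) _; first by rewrite mulr_ge0 // exprn_ge0.
pose q := (m + m).+1%:R * m%:R ^+ 2 / n ^+ 3.
have -> : k * ((m + m).+1%:R * m%:R ^+ 2) = p1 * p2 / 32 * q by rewrite /k /q; ring.
have q2 : q <= 2.
  rewrite /q ler_pdivrMr ?(lt_le_trans _ n1) // nE.
  by rewrite -natr1 natrD; move: (m%:R : R) mR => z z1; nra.
have pp : 0 <= p1 * p2 / 32 by rewrite divr_ge0 ?mulr_ge0 //; lra.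
apply: le_trans (ler_wpM2l pp q2) _; nra.
Qed.

Lemma uniform_kernel (N : nat) (s : int) (L : kernel R (level N s)) a :
  (a <= N)%N -> (forall x : spins N, (mag x == s) = (plus x == a)) ->
  (forall x y, L x y = 1 / 'C(N, a)%:R) ->
  [/\ markov L, symmetric_kernel L & 1 <= gap L].
Proof.
move=> aN ma LE; have cL : #|{: level N s}| = 'C(N, a) := card_level ma.
have c0 : 'C(N, a)%:R != 0 :> R by rewrite bin_neq0.
have Lm : markov L.
  split=> [x y|x]; first by rewrite LE divr_ge0.
  under eq_bigr do rewrite LE.
  by rewrite sumr_const cL -[_ *+ _]mulr_natr divfK.
have Ls : symmetric_kernel L by move=> x y; rewrite !LE.
split=> //; apply: gap_uniform_ge1 => //; first by rewrite cL bin_gt0.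
by move=> x y; rewrite LE cL div1r.
Qed.

End Assembly.

Unset Implicit Arguments.

Theorem proposition5p3 (R : realType) (p1 p2 : R)
  (hp1 : 0 < p1 < 1) (hp2 : 0 < p2 < 1) (hp : p1 + p2 < 1) :
  (forall (N : nat) (beta : R)
     (K0 : kernel R (level N 0))
     (Kp : forall i : nat, kernel R (level N i%:Z))
     (Km : forall i : nat, kernel R (level N (- i%:Z))),
     (2 <= N)%N -> ~~ odd N -> 0 < beta ->
     admissible K0 ->
     (forall i : nat, level_index N i -> admissible (Kp i) /\ admissible (Km i)) ->
     p1 * p2 / 32 * (1 / (N%:R / 2 + 1) ^+ 3) *
       Num.min ((1 - p1) / p2 * gap K0)
               ((1 - p1 - p2) / 2 * min_gap Kp Km)
     <= gap (metropolis (ising beta) (proposal p1 p2 K0 Kp Km)))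
  /\
  (forall beta : R, 0 < beta ->
     exists N0 : nat, forall N : nat, (N0 <= N)%N -> (2 <= N)%N -> ~~ odd N ->
     forall (K0 : kernel R (level N 0))
       (Kp : forall i : nat, kernel R (level N i%:Z))
       (Km : forall i : nat, kernel R (level N (- i%:Z))),
     (forall x y, K0 x y = 1 / 'C(N, N./2)%:R) ->
     (forall i : nat, level_index N i ->
        (forall x y, Kp i x y = 1 / 'C(N, (N - i)./2)%:R) /\
        (forall x y, Km i x y = 1 / 'C(N, (N - i)./2)%:R)) ->
     p1 * p2 / 32 * (1 / (N%:R / 2 + 1) ^+ 3) *
       Num.min ((1 - p1 - p2) / 2) ((1 - p1) / p2)
     <= gap (metropolis (ising beta) (proposal p1 p2 K0 Kp Km))).
Proof.
(* The second part is the first with all gaps equal to 1, for every N. *)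
have [[p1_gt0 p1_lt1] [p2_gt0 _]] := (andP hp1, andP hp2).
have halves N : (2 <= N)%N -> ~~ odd N -> exists2 m, (0 < m)%N & N = (m + m)%N.
  by move=> N2 Nodd; exists N./2; lia.
split=> [N beta K0 Kp Km N2 Nodd beta0 K0adm Kadm|beta beta0].
  have [m m0 E] := halves N N2 Nodd; subst N.
  apply: gap_bound => // [|i ii|i ii]; first by case: K0adm.
    by have [[]] := Kadm i ii.
  by have [_ []] := Kadm i ii.
exists 0%N => N _ N2 Nodd K0 Kp Km K0E KE.
have [m m0 E] := halves N N2 Nodd; subst N.
have half_m : (m + m)./2 = m by lia.
have [K0m K0s K0g] : [/\ markov K0, symmetric_kernel K0 & 1 <= gap K0].
  apply: (uniform_kernel (a := m)) => [||x y]; [lia|exact: level_zero|].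
  by rewrite K0E half_m.
have Kpu i : level_index (m + m) i ->
    [/\ markov (Kp i), symmetric_kernel (Kp i) & 1 <= gap (Kp i)].
  move=> ii; apply: (uniform_kernel (a := (m + i./2)%N)) => [|x|x y].
  - by move: ii; rewrite /level_index; lia.
  - exact: level_pos.
  have [-> _] := KE i ii; rewrite -bin_sub; last by move: ii; rewrite /level_index; lia.
  by congr (_ / 'C(_, _)%:R); move: ii; rewrite /level_index; lia.
have Kmu i : level_index (m + m) i ->
    [/\ markov (Km i), symmetric_kernel (Km i) & 1 <= gap (Km i)].
  move=> ii; apply: (uniform_kernel (a := (m - i./2)%N)) => [|x|x y].
  - by move: ii; rewrite /level_index; lia.
  - exact: level_neg.
  have [_ ->] := KE i ii.
  by congr (_ / 'C(_, _)%:R); move: ii; rewrite /level_index; lia.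
apply: le_trans (gap_bound p1_gt0 p2_gt0 hp m0 beta0 _ _ _); first last.
- by move=> i /Kmu [].
- by move=> i /Kpu [].
- by [].
apply: ler_wpM2l.
  rewrite mulr_ge0 ?divr_ge0 ?mulr_ge0 ?exprn_ge0 ?addr_ge0 ?divr_ge0 //; exact: ltW.
have mg1 : 1 <= min_gap Kp Km.
  rewrite /min_gap big_nat_cond; apply: (big_ind (fun v => 1 <= v)) => [|u v u1 v1|i ii].
  - have NN : level_index (m + m) (m + m) by rewrite /level_index; lia.
    by have [[_ _ gp] [_ _ gm]] := (Kpu _ NN, Kmu _ NN); rewrite le_min gp gm.
  - by rewrite le_min u1.
  have ii' : level_index (m + m) i by rewrite /level_index; lia.
  by have [[_ _ gp] [_ _ gm]] := (Kpu _ ii', Kmu _ ii'); rewrite le_min gp gm.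
rewrite le_min !ge_min; apply/andP; split; apply/orP; [right|left].
  by rewrite -[leLHS]mulr1 ler_wpM2l // divr_ge0 //; lra.
by rewrite -[leLHS]mulr1 ler_wpM2l // divr_ge0 //; lra.
Qed.
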